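(* Let $\delta\in(0,n]$ and $p\in(1,\infty)$. Then $f\in \mathrm{BMO}(\mathbb R^n,\mathcal H_\infty^\delta)$ if and only if $e^{\alpha f}\in\mathcal A_{p,\delta}$ for some positive constant $\alpha$; more precisely: (i) if $w\in\mathcal A_{p,\delta}$, then $\ln w\in \mathrm{BMO}(\mathbb R^n,\mathcal H_\infty^\delta)$ and there exists a positive constant $C=C(n,\delta,p)$ (depending only on $n,\delta,p$) such that $$\|\ln w\|_{\mathrm{BMO}(\mathbb R^n,\mathcal H_\infty^\delta)}\le C\,[w]_{\mathcal A_{p,\delta}}^{\min\{1,\frac1{p-1}\}};$$ (ii) conversely, there exist positive constants $c_1=c_1(n,\delta,p)$ and $c_2=c_2(n,\delta,p)$ such that, for every $f\in \mathrm{BMO}(\mathbb R^n,\mathcal H_\infty^\delta)$ with $\|f\|_{\mathrm{BMO}(\mathbb R^n,\mathcal H_\infty^\delta)}\neq0$, $$\exp\left(\frac{c_1 f}{\|f\|_{\mathrm{BMO}(\mathbb R^n,\mathcal H_\infty^\delta)}}\right)\in\mathcal A_{p,\delta}\quad\text{and}\quad \left[\exp\left(\frac{c_1 f}{\|f\|_{\mathrm{BMO}(\mathbb R^n,\mathcal H_\infty^\delta)}}\right)\right]_{\mathcal A_{p,\delta}}\le c_2.$$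
   Context: A cube $Q\subset\mathbb R^n$ is always left-open and right-closed with sides parallel to the coordinate axes; $l(Q)$ is its edge length. For $\delta\in(0,n]$ and $E\subset\mathbb R^n$ the Hausdorff content is $\mathcal H_\infty^\delta(E)=\inf\{\sum_i l(Q_i)^\delta: E\subset\bigcup_iQ_i\}$, the infimum over all finite or countable coverings by cubes. For any (not necessarily measurable) $f\ge0$, the Choquet integral is $\int_E f(x)\,d\mathcal H_\infty^\delta=\int_0^\infty\mathcal H_\infty^\delta(\{x\in E:f(x)>t\})\,dt$. $L^1_{\rm loc}(\mathbb R^n,\mathcal H_\infty^\delta)$ is the set of functions $f$ with $\int_K|f|\,d\mathcal H_\infty^\delta<\infty$ for every compact $K$. ''$\mathcal H_\infty^\delta$-almost everywhere'' means outside a set of content zero; values on such sets are irrelevant. A weight is a function $w\in L^1_{\rm loc}(\mathbb R^n,\mathcal H_\infty^\delta)$ with $w\in(0,\infty)$ $\mathcal H_\infty^\delta$-a.e. For $p\in(1,\infty)$, $\mathcal A_{p,\delta}$ is the set of weights $w$ with $$[w]_{\mathcal A_{p,\delta}}=\sup_Q\left\{\frac1{\mathcal H_\infty^\delta(Q)}\int_Q w\,d\mathcal H_\infty^\delta\right\}\left\{\frac1{\mathcal H_\infty^\delta(Q)}\int_Q w^{-\frac1{p-1}}\,d\mathcal H_\infty^\delta\right\}^{p-1}<\infty,$$ the supremum over all cubes $Q$. $\mathrm{BMO}(\mathbb R^n,\mathcal H_\infty^\delta)$ is the set of $f\in L^1_{\rm loc}(\mathbb R^n,\mathcal H_\infty^\delta)$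 (real-valued) with $$\|f\|_{\mathrm{BMO}(\mathbb R^n,\mathcal H_\infty^\delta)}=\sup_Q\inf_{c\in\mathbb R}\frac1{\mathcal H_\infty^\delta(Q)}\int_Q|f(x)-c|\,d\mathcal H_\infty^\delta<\infty,$$ the supremum over all cubes $Q$. *)

(* Defs.v *)
From HB Require Import structures.
From mathcomp Require Import all_boot all_order all_algebra.
From mathcomp Require Import all_classical all_reals all_analysis.

Set Implicit Arguments.
Unset Strict Implicit.
Unset Printing Implicit Defensive.

Import Order.TTheory GRing.Theory Num.Theory.
Import numFieldNormedType.Exports.

Local Open Scope classical_set_scope.
Local Open Scope ring_scope.
Local Open Scope ereal_scope.

Section HausdorffContent.
Context {R : realType} {n : nat}.
Implicit Types (E : set 'rV[R]_n) (delta p : R).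

Record cube := Cube { corner : 'rV[R]_n ; edge : {posnum R} }.

Definition cube_set (Q : cube) : set 'rV[R]_n :=
  [set x | forall i, (corner Q ord0 i < x ord0 i <=
                      corner Q ord0 i + (edge Q)%:num)%R].

(* A finite or countable family of cubes is the restriction of a sequence of
   cubes to a set D of indices. *)
Definition hcontent delta E : \bar R :=
  ereal_inf [set s | exists (D : set nat) (Q : nat -> cube),
    E `<=` \bigcup_(i in D) cube_set (Q i) /\
    s = \esum_(i in D) (((edge (Q i))%:num `^ delta)%R)%:E].

Definition hc_ae delta (P : 'rV[R]_n -> Prop) : Prop :=
  exists2 N : set 'rV[R]_n, hcontent delta N = 0 & forall x, ~ N x -> P x.

(* For f >= 0 only: the negative part of f is ignored. *)
Definition choquet delta E (f : 'rV[R]_n -> \bar R) : \bar R :=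
  \int[lebesgue_measure]_(t in `[0%R, +oo[)
    hcontent delta [set x | E x /\ t%:E < f x].

Definition choquet_mean delta (Q : cube) (f : 'rV[R]_n -> \bar R) : \bar R :=
  (hcontent delta (cube_set Q))^-1 * choquet delta (cube_set Q) f.

Definition L1loc delta (f : 'rV[R]_n -> \bar R) : Prop :=
  forall K : set 'rV[R]_n, compact K -> choquet delta K (fun x => `|f x|) < +oo.

(* Weights are extended-real-valued: the values 0 and +oo (and junk values)
   are allowed on a set of content zero. *)
Definition weight delta (w : 'rV[R]_n -> \bar R) : Prop :=
  L1loc delta w /\ hc_ae delta (fun x => 0 < w x < +oo).

Definition Ap_const p delta (w : 'rV[R]_n -> \bar R) : \bar R :=
  ereal_sup (range (fun Q : cube =>
    choquet_mean delta Q w *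
    choquet_mean delta Q (fun x => w x `^ (- (1 / (p - 1)))%R) `^ (p - 1)%R)).

Definition Ap p delta (w : 'rV[R]_n -> \bar R) : Prop :=
  weight delta w /\ Ap_const p delta w < +oo.

Definition bmo_norm delta (f : 'rV[R]_n -> R) : \bar R :=
  ereal_sup (range (fun Q : cube =>
    ereal_inf (range (fun c : R =>
      choquet_mean delta Q (fun x => `|f x - c|%:E))))).

Definition BMO delta (f : 'rV[R]_n -> R) : Prop :=
  L1loc delta (EFin \o f) /\ bmo_norm delta f < +oo.

End HausdorffContent.

(* Main.v *)
(* Every estimate is phrased through the tails t |-> H{x in Q : |f x - c| > t}
   of a function on a cube Q of edge l, where H(Q) = l^delta.

   BMO to A_p: the John-Nirenberg inequality.  By Chebyshev,
   E = {x in Q : |f - c_Q| > t0} has small content for t0 a large multiple of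
   the norm.  Take a cover (Q_j) of E with small sum of l_j^delta and let nu be
   the discrete measure putting mass l_j^delta at each vertex of Q_j.  The
   maximal dyadic subcubes P of Q with nu(P) > theta l(P)^delta are disjoint, so
   additivity of nu, which replaces that of the content, bounds the sum of
   l(P)^delta; their parents cover E and are not dense in E.  Hence c_Q and the
   c of each parent differ by at most a multiple T of the norm, and iterating
   over the parents gives H{|f - c_Q| > k T} <= 2^-k l^delta.  Exponential tails
   bound the means of exp(a f) and exp(- a f / (p - 1)) for small a.

   A_p to BMO: with W and V the means of w and w^(-1/(p-1)) over Q, Chebyshev
   bounds the two tails of ln w - c; one takes c = ln W if p >= 2 and
   c = - (p - 1) ln V otherwise. *)
Require Import Defs.
From mathcomp Require Import all_boot all_order all_algebra.
From mathcomp Require Import all_classical all_reals all_analysis.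
From mathcomp Require Import measurable_realfun zify ring lra.

Import Order.TTheory GRing.Theory Num.Theory.
Import numFieldNormedType.Exports.

Local Open Scope classical_set_scope.
Local Open Scope ring_scope.
Local Open Scope ereal_scope.

(** * Unordered sums and the volume bound for coverings by boxes *)

Lemma esum_subset {R : realType} {T : choiceType} (A B : set T) (f : T -> \bar R) :
  A `<=` B -> \esum_(i in A) f i <= \esum_(i in B) f i.
Proof.
move=> AB; apply: ereal_sup_le => _ [X [finX XA] <-].
by exists X => //; split=> //; exact: subset_trans AB.
Qed.

Lemma esum_ge1 {R : realType} {T : choiceType} (A : set T) (f : T -> \bar R) i :
  A i -> 0 <= f i -> f i <= \esum_(j in A) f j.
Proof.
move=> Ai fi; rewrite -{1}(esum_set1 fi).
by apply: esum_subset => _ ->.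
Qed.

Lemma esumZl {R : realType} {T : choiceType} (A : set T) (f : T -> \bar R)
    (c : R) : (0 < c)%R -> (forall i, 0 <= f i) ->
  \esum_(i in A) (c%:E * f i) = c%:E * \esum_(i in A) f i.
Proof.
have le_esumZ (d : R) (g : T -> \bar R) : (0 < d)%R -> (forall i, 0 <= g i) ->
    \esum_(i in A) (d%:E * g i) <= d%:E * \esum_(i in A) g i.
  move=> d0 g0; apply: ge_ereal_sup => _ [X [finX XA] <-].
  rewrite -ge0_mule_fsumr//; apply: lee_wpmul2l; first by rewrite lee_fin ltW.
  by apply: ereal_sup_ubound; exists X.
move=> c0 f0; apply/eqP; rewrite eq_le le_esumZ//= -lee_pdivlMl//.
apply: le_trans (le_esumZ _ _ _ _); rewrite ?invr_gt0//.
  by apply: le_esum => i _; rewrite muleA -EFinM mulVf ?mul1e// gt_eqF.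
by move=> i; rewrite mule_ge0// lee_fin ltW.
Qed.

(** Induction on the dimension by slicing: the boxes whose last side contains [y] cover the slice at
    height [y], so the sum of [l j ^+ n] over these boxes is at least [L ^+ n]; integrating over [y]
    adds one factor to each side. Points are functions on [nat], of which only the first [n] values
    count, so that all dimensions share one type. *)
Lemma box_cover_volume {R : realType} (n : nat) (D : set nat)
    (a : nat -> nat -> R) (l : nat -> R) (b : nat -> R) (L : R) :
  (0 < L)%R -> (forall j, 0 <= l j)%R ->
  (forall x : nat -> R, (forall i, (i < n)%N -> (b i < x i <= b i + L)%R) ->
     exists2 j, D j & forall i, (i < n)%N -> (a j i < x i <= a j i + l j)%R) ->
  (L ^+ n)%:E <= \esum_(j in D) (l j ^+ n)%:E.
Proof.
move=> L0 l0; elim: n D => [|n IH] D cov.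
  have [//|j Dj _] := cov b.
  rewrite expr0; apply: (@le_trans _ _ (l j ^+ 0)%:E); first by rewrite expr0.
  by apply: (@esum_ge1 _ _ _ (fun j => (l j ^+ 0)%:E)) => //=; rewrite expr0 lee01.
pose I j : set (measurableTypeR R) := [set` `]a j n, (a j n + l j)%R]].
pose A : set (measurableTypeR R) := [set` `]b n, (b n + L)%R]].
(* The zero outside [D] turns the sum over [D] into a series over all indices, to which termwise
   integration applies. *)
pose c j : R := if j \in D then (l j ^+ n)%R else 0%R.
have c0 j : (0 <= c j)%R by rewrite /c; case: ifP => // _; rewrite exprn_ge0.
pose g j (y : measurableTypeR R) : \bar R := (c j)%:E * (\1_(I j) y)%:E.
have g0 j y : 0 <= g j y by rewrite mule_ge0// ?lee_fin.
have mI j : measurable (I j) by exact: measurable_itv.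
have mA : measurable A by exact: measurable_itv.
have mg j : measurable_fun A (g j).
  apply: measurable_funeM; apply/measurable_EFinP.
  exact: measurable_indic.
have itvE (u v : R) : (0 <= v)%R ->
    (lebesgue_measure : set (measurableTypeR R) -> \bar R) [set` `]u, (u + v)%R]]
      = v%:E.
  move=> v0; have -> := lebesgue_measure_itv `]u, (u + v)%R].
  rewrite /= lte_fin ltrDl -EFinD addrAC subrr add0r.
  by case: ltgtP v0 => // <-.
have slice y : A y -> (L ^+ n)%:E <= \sum_(j <oo) g j y.
  rewrite /A /= in_itv/= => Ay.
  apply: (le_trans (IH (D `&` [set j | I j y]) _)).
    move=> x xb; have [|j Dj jx] := cov (fun i => if (i < n)%N then x i else y).
      move=> i; rewrite ltnS leq_eqVlt => /orP[/eqP ->|iln]; last first.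
        by rewrite iln; exact: xb.
      by rewrite ltnn.
    exists j; last by move=> i iln; have := jx i (ltnW iln); rewrite iln.
    split => //; have := jx n (ltnSn n); rewrite ltnn /I/= in_itv/=.
    by move=> ->.
  rewrite nneseries_esumT// esum_mkcond; apply: le_esum => j _.
  rewrite /g /c indicE in_setI.
  rewrite (_ : (j \in [set k | I k y]) = (y \in I j)); last first.
    by apply/idP/idP; rewrite !inE.
  by case: (j \in D) => /=; case: (y \in I j); rewrite ?mule1 ?mule0 ?mul0e.
have : \int[lebesgue_measure]_(y in A) (L ^+ n)%:E <=
    \int[lebesgue_measure]_(y in A) \sum_(j <oo) g j y.
  apply: ge0_le_integral => //.
  - by move=> y _; rewrite lee_fin exprn_ge0// ltW.
  - exact: ge0_emeasurable_sum.
rewrite integral_nneseries//.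
rewrite (integral_cst _ mA) [X in _ * X <= _](_ : _ = L%:E); last first.
  exact/itvE/ltW.
rewrite -EFinM -exprSr => /le_trans; apply.
rewrite esum_mkcond nneseries_esumT; last by move=> j; exact: integral_ge0.
apply: le_esum => j _.
rewrite ge0_integralZl_EFin//; last by apply/measurable_EFinP; exact: measurable_indic.
rewrite integral_indic//.
apply: (@le_trans _ _ ((c j)%:E * (l j)%:E)).
  apply: lee_wpmul2l; first by rewrite lee_fin.
  by rewrite -(itvE (a j n) (l j))// le_measure ?inE//; exact: measurableI.
by rewrite /c; case: ifP => _; rewrite -EFinM ?mul0r// -exprSr.
Qed.

(** * Hausdorff content: countable subadditivity and the content of a cube *)

Section Content.
Context {R : realType} {n : nat}.
Variable delta : R.
Implicit Types (E F : set 'rV[R]_n) (Q : @cube R n).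

Let cube1 : @cube R n := Cube 0%R (PosNum ltr01).

Lemma hcontent_cover {I : countType} (A : set I) (Q : I -> @cube R n) E :
  E `<=` \bigcup_(i in A) cube_set (Q i) ->
  hcontent delta E <= \esum_(i in A) ((edge (Q i))%:num `^ delta)%:E.
Proof.
move=> EQ; pose Q' k := if unpickle k is Some i then Q i else cube1.
have Q'E i : Q' (pickle i) = Q i by rewrite /Q' pickleK.
apply: ereal_inf_lbound => /=; exists (pickle @` A), Q'; split.
  move=> x /EQ [i Ai Qix]; exists (pickle i); first by exists i.
  by rewrite Q'E.
rewrite esum_image; last by move=> i j _ _; exact: (pcan_inj pickleK).
by apply: eq_esum => i _; rewrite Q'E.
Qed.

Lemma hcontent_lt_cover E (u : \bar R) : hcontent delta E < u ->
  exists (D : set nat) (Q : nat -> @cube R n),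
    E `<=` \bigcup_(i in D) cube_set (Q i) /\
    \esum_(i in D) ((edge (Q i))%:num `^ delta)%:E < u.
Proof.
by move=> /ereal_inf_lt [_ [D [Q [EQ ->]]] su]; exists D, Q.
Qed.

Lemma hcontent_ge0 E : 0 <= hcontent delta E.
Proof.
apply: le_ereal_inf_tmp => _ [D [Q [_ ->]]].
by apply: esum_ge0 => i _; rewrite lee_fin powR_ge0.
Qed.

Lemma hcontent_mono E F : E `<=` F -> hcontent delta E <= hcontent delta F.
Proof.
move=> EF; apply: le_ereal_inf_tmp => _ [D [Q [FQ ->]]].
by apply: hcontent_cover; exact: subset_trans FQ.
Qed.

Lemma hcontent0 : hcontent delta (set0 : set 'rV[R]_n) = 0.
Proof.
apply/eqP; rewrite eq_le hcontent_ge0 andbT.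
have := @hcontent_cover nat set0 (fun=> cube1) set0.
by rewrite esum_set0; apply.
Qed.

Lemma hcontent_cube_le Q : hcontent delta (cube_set Q) <= ((edge Q)%:num `^ delta)%:E.
Proof.
have := @hcontent_cover unit setT (fun=> Q) (cube_set Q).
rewrite (_ : [set: unit] = [set tt]); last by apply/seteqP; split=> -[].
rewrite esum_set1 ?lee_fin ?powR_ge0//; apply.
by move=> x Qx; exists tt.
Qed.

Let hcontent_bigcup_nat (A : set nat) (F : nat -> set 'rV[R]_n) :
  hcontent delta (\bigcup_(i in A) F i) <= \esum_(i in A) hcontent delta (F i).
Proof.
(* A piece of infinite content is set apart: covers within [e / 2 ^ i.+1] of the content exist only
   when it is finite. *)
have [[i [Ai Fi]]|Ffin] := pselect (exists i, A i /\ hcontent delta (F i) = +oo).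
  rewrite (_ : \esum_(i in A) _ = +oo) ?leey//; apply/eqP; rewrite -leye_eq -Fi.
  by apply: (@esum_ge1 _ _ _ (fun i => hcontent delta (F i))) => //; exact: hcontent_ge0.
apply/lee_addgt0Pr => e e0.
have /choice[DQ DQP] : forall i, exists DQ : set nat * (nat -> @cube R n), A i ->
    F i `<=` \bigcup_(j in DQ.1) cube_set (DQ.2 j) /\
    \esum_(j in DQ.1) ((edge (DQ.2 j))%:num `^ delta)%:E <=
      hcontent delta (F i) + (e / (2 ^ i.+1)%:R)%:E.
  move=> i; have [Ai|nAi] := pselect (A i); last first.
    by exists (set0, fun=> cube1).
  have : hcontent delta (F i) < hcontent delta (F i) + (e / (2 ^ i.+1)%:R)%:E.
    rewrite lteDl ?lte_fin ?divr_gt0// ?ltr0n ?expn_gt0//.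
    by rewrite ge0_fin_numE ?hcontent_ge0// ltey; apply/eqP => Fi; apply: Ffin; exists i.
  move=> /hcontent_lt_cover [D [Q [FQ lt]]]; exists (D, Q) => _; split => //.
  exact: ltW.
apply: (@le_trans _ _ (\esum_(k in A `*`` (fun i => (DQ i).1))
    ((edge ((DQ k.1).2 k.2))%:num `^ delta)%:E)).
  apply: (@hcontent_cover (nat * nat)%type) => x [i Ai Fix].
  have [sub _] := DQP i Ai; have [j Dj Qx] := sub x Fix.
  by exists (i, j).
rewrite -(@esum_esum _ _ _ A (fun i => (DQ i).1)
  (fun i j => ((edge ((DQ i).2 j))%:num `^ delta)%:E)); last first.
  by move=> *; rewrite lee_fin powR_ge0.
apply: (@le_trans _ _ (\esum_(i in A) (hcontent delta (F i) + (e / (2 ^ i.+1)%:R)%:E))).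
  by apply: le_esum => i Ai; have [] := DQP i Ai.
have e2 i : 0 <= (e / (2 ^ i.+1)%:R)%:E by rewrite lee_fin divr_ge0 ?ltW.
have := @epsilon_trick R (fun i => hcontent delta (F i)) e (mem A)
  (fun i => hcontent_ge0 (F i)) (ltW e0).
rewrite !nneseries_esum//; last 2 first.
  by move=> i _; rewrite ?adde_ge0 ?hcontent_ge0.
  by move=> i _; rewrite ?adde_ge0 ?hcontent_ge0.
by rewrite set_mem_set.
Qed.

Lemma hcontent_bigcup {I : countType} (A : set I) (F : I -> set 'rV[R]_n) :
  hcontent delta (\bigcup_(i in A) F i) <= \esum_(i in A) hcontent delta (F i).
Proof.
pose F' k := if unpickle k is Some i then F i else set0.
have F'E i : F' (@pickle I i) = F i by rewrite /F' pickleK.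
apply: (@le_trans _ _ (hcontent delta (\bigcup_(k in pickle @` A) F' k))).
  apply: hcontent_mono => x [i Ai Fix]; exists (pickle i); first by exists i.
  by rewrite F'E.
apply: (le_trans (hcontent_bigcup_nat _ _)).
rewrite esum_image; last by move=> i j _ _; exact: (pcan_inj pickleK).
by under eq_esum => i _ do rewrite F'E.
Qed.

Lemma hcontentU E F :
  hcontent delta (E `|` F) <= hcontent delta E + hcontent delta F.
Proof.
have := @hcontent_bigcup bool setT (fun b => if b then E else F).
rewrite (@esumID _ _ [set true])//; last by move=> []; rewrite hcontent_ge0.
rewrite !setTI (_ : ~` [set true] = [set false]); last first.
  by apply/seteqP; split=> [[]//= /(_ erefl)|_ ->].
rewrite !esum_set1 ?hcontent_ge0//; apply: le_trans; apply: hcontent_mono.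
by move=> x [Ex|Fx]; [exists true | exists false].
Qed.

Hypothesis hdelta : (0 < delta <= n%:R)%R.

(** For the lower bound, a covering cube with edge at least [L] suffices alone. If all edges are at
    most [L], then [delta <= n] gives [l ^ delta >= L ^ (delta - n) * l ^ n], and the volume bound
    concludes. *)
Lemma hcontent_cubeE Q : hcontent delta (cube_set Q) = ((edge Q)%:num `^ delta)%:E.
Proof.
have /andP[d0 dn] := hdelta.
apply/eqP; rewrite eq_le hcontent_cube_le/=.
apply: le_ereal_inf_tmp => _ [D [P [QP ->]]].
have : (0 < (edge Q)%:num)%R by [].
set L := (edge Q)%:num => L0.
have l0 j : (0 <= (edge (P j))%:num)%R by [].
have [[j [Dj Lj]]|small] := pselect (exists j, D j /\ (L <= (edge (P j))%:num)%R).
  apply: (@le_trans _ _ ((edge (P j))%:num `^ delta)%:E).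
    by rewrite lee_fin ge0_ler_powR ?nnegrE// ltW.
  apply: (@esum_ge1 _ _ _ (fun j => ((edge (P j))%:num `^ delta)%:E)) => //=.
(* Coordinates extended by 0 beyond [n], to match the indexing of [box_cover_volume]. *)
pose at_ (x : 'rV[R]_n) (i : nat) := if insub i is Some k then x ord0 k else 0%R.
have at_E x (k : 'I_n) : at_ x k = x ord0 k by rewrite /at_ valK.
have := @box_cover_volume R n D (fun j => at_ (corner (P j)))
  (fun j => (edge (P j))%:num) (at_ (corner Q)) L L0 l0.
have cov x : (forall i : nat, (i < n)%N ->
    (at_ (corner Q) i < x i <= at_ (corner Q) i + L)%R) ->
   exists2 j : nat, D j & forall i : nat, (i < n)%N ->
    (at_ (corner (P j)) i < x i <= at_ (corner (P j)) i + (edge (P j))%:num)%R.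
  move=> xQ; have /QP[j Dj Pj] : cube_set Q (\row_i x i).
    by move=> i; rewrite mxE -at_E; exact: xQ.
  by exists j => // i iln; have := Pj (Ordinal iln); rewrite mxE -at_E.
move=> /(_ cov) Vol.
have cE : (L `^ delta)%:E = (L `^ (delta - n%:R))%:E * (L ^+ n)%:E.
  rewrite -EFinM -powR_mulrn ?ltW// -powRD ?subrK//.
  by rewrite (gt_eqF L0) implybT.
rewrite cE; apply: (le_trans (lee_wpmul2l _ Vol)); first by rewrite lee_fin powR_ge0.
rewrite -esumZl ?powR_gt0//; apply: le_esum => j Dj.
rewrite -EFinM lee_fin -powR_mulrn//.
have jL : ((edge (P j))%:num <= L)%R.
  by rewrite leNgt; apply/negP => Lj; apply: small; exists j; split => //; exact: ltW.
rewrite [leRHS](_ : _ = ((edge (P j))%:num `^ (delta - n%:R) *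
    (edge (P j))%:num `^ n%:R)%R); last first.
  by rewrite -powRD ?subrK// gt_eqF// implybT.
rewrite ler_wpM2r ?powR_ge0// -(opprB n%:R) !powRN lef_pV2 ?posrE ?powR_gt0//.
by rewrite ge0_ler_powR ?nnegrE ?subr_ge0// ltW.
Qed.

Lemma hcontent_cube_gt0 Q : 0 < hcontent delta (cube_set Q).
Proof. by rewrite hcontent_cubeE lte_fin powR_gt0. Qed.

End Content.

(** * The Choquet integral: Chebyshev's inequality and bounds by series *)

Lemma nonincreasing_emeasurable {R : realType} (D : set (measurableTypeR R))
    (G : measurableTypeR R -> \bar R) :
  measurable D -> {homo G : s t / (s <= t)%R >-> t <= s} -> measurable_fun D G.
Proof.
move=> mD Gmono; apply: (measurability _ (ErealGenCInfty.measurableE R)) => //.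
move=> _ [_ [r ->] <-]; apply: measurableI => //.
(* The superlevel sets of a monotone function are intervals. *)
apply: is_interval_measurable => s t /=.
rewrite !in_itv/= !andbT => Gs Gt u /andP[su ut].
by rewrite in_itv/= andbT (le_trans Gt)// Gmono.
Qed.

Section Choquet.
Context {R : realType} {n : nat}.
Variable delta : R.
Implicit Types (E F : set 'rV[R]_n) (f g : 'rV[R]_n -> \bar R).

Let level E f (t : measurableTypeR R) :=
  hcontent delta [set x | E x /\ t%:E < f x].

Let level_ge0 E f t : 0 <= level E f t.
Proof. exact: hcontent_ge0. Qed.

Let level_mono E f s t : (s <= t)%R -> level E f t <= level E f s.
Proof.
move=> st; apply: hcontent_mono => x [Ex fx]; split => //.
by apply: le_lt_trans fx; rewrite lee_fin.
Qed.

(** Monotonicity in [t] alone makes the integrand measurable, for an arbitrary [f]. *)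
Let mlevel D E f : measurable D -> measurable_fun D (level E f).
Proof.
by move=> mD; apply: nonincreasing_emeasurable => // s t; exact: level_mono.
Qed.

Lemma choquet_ge0 E f : 0 <= choquet delta E f.
Proof. by apply: integral_ge0 => t _; exact: level_ge0. Qed.

Lemma le_choquet E F f g :
  (forall t : R, (0 <= t)%R -> hcontent delta [set x | E x /\ t%:E < f x] <=
     hcontent delta [set x | F x /\ t%:E < g x]) ->
  choquet delta E f <= choquet delta F g.
Proof.
move=> fg; apply: ge0_le_integral => //.
- by move=> t _; exact: level_ge0.
- exact: (mlevel _ E f).
- exact: (mlevel _ F g).
by move=> t /=; rewrite in_itv/= andbT => /fg.
Qed.

(** On [[0, t[] the nonincreasing integrand is at least its value at [t]. *)
Lemma choquet_chebyshev E f (t : R) : (0 <= t)%R ->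
  t%:E * hcontent delta [set x | E x /\ t%:E < f x] <= choquet delta E f.
Proof.
move=> t0; pose I : set (measurableTypeR R) := [set` `[0%R, t[].
have mI : measurable I by exact: measurable_itv.
have muI : (lebesgue_measure : set (measurableTypeR R) -> \bar R) I = t%:E.
  have -> := lebesgue_measure_itv `[0%R, t[.
  by rewrite /= lte_fin sube0; case: ltgtP t0 => // <-.
have := @integral_cst _ _ _
  (lebesgue_measure : {measure set (measurableTypeR R) -> \bar R}) _ mI (level E f t).
rewrite [X in _ = _ * X](_ : _ = t%:E)// muleC => <-.
apply: (@le_trans _ _ (\int[lebesgue_measure]_(s in I) level E f s)).
  apply: ge0_le_integral => //.
  - by move=> s _; exact: level_ge0.
  - exact: (mlevel _ E f).
  move=> s; rewrite /I/= in_itv/= => /andP[_ st].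
  by apply: level_mono; exact: ltW.
apply: ge0_subset_integral => //.
- exact: (mlevel _ E f).
by move=> s; rewrite /I/= !in_itv/= andbT => /andP[].
Qed.

Lemma choquet_level_le E f (m t : R) : (0 < t)%R -> choquet delta E f <= m%:E ->
  hcontent delta [set x | E x /\ t%:E < f x] <= (m / t)%:E.
Proof.
move=> t0 fm; rewrite mulrC EFinM lee_pdivlMl//.
exact: le_trans (choquet_chebyshev _ _ _ (ltW t0)) fm.
Qed.

(** The set is the union of the levels above [1 / k.+1]; each is null by Chebyshev, and countable
    subadditivity applies. *)
Lemma choquet_eq0_level E f :
  choquet delta E f = 0 -> hcontent delta [set x | E x /\ 0 < f x] = 0.
Proof.
move=> f0; apply/eqP; rewrite eq_le hcontent_ge0 andbT.
have -> : [set x | E x /\ 0 < f x] =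
    \bigcup_(k in [set: nat]) [set x | E x /\ (k.+1%:R^-1)%:E < f x].
  apply/seteqP; split=> [x [Ex fx]|x [k _ [Ex fx]]]; last first.
    by split=> //; apply: lt_trans fx; rewrite lte_fin invr_gt0.
  case fxE : (f x) fx => [r||]//; last by exists 0%N => //; split => //; rewrite fxE ltry.
  rewrite lte_fin => r0; have [k kr] := ltr_add_invr r0.
  exists k => //; split => //; rewrite fxE lte_fin.
  by rewrite add0r in kr.
apply: (le_trans (hcontent_bigcup _ _ _)); rewrite esum1// => k _.
apply/eqP; rewrite eq_le hcontent_ge0 andbT.
have k0 : (0 <= k.+1%:R^-1 :> R)%R by rewrite invr_ge0.
have := choquet_chebyshev E f _ k0; rewrite f0.
by rewrite pmule_rle0// lte_fin invr_gt0.
Qed.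

(** An upper Riemann sum: on [[u k, u k.+1[] the content of the level set is at most its value at
    the left end. *)
Lemma choquet_le_series E f (u : nat -> R) :
  u 0%N = 0%R -> {homo u : j k / (j <= k)%N >-> (j <= k)%R} ->
  (forall t, exists k, (t < u k)%R) ->
  choquet delta E f <= \sum_(k <oo)
    ((u k.+1 - u k)%:E * hcontent delta [set x | E x /\ (u k)%:E < f x]).
Proof.
move=> u0 umono uoo.
pose I k : set (measurableTypeR R) := [set` `[u k, u k.+1[].
have mI k : measurable (I k) by exact: measurable_itv.
have muI k : (lebesgue_measure : set (measurableTypeR R) -> \bar R) (I k) =
    (u k.+1 - u k)%:E.
  have -> := lebesgue_measure_itv `[u k, u k.+1[.
  rewrite /= lte_fin -EFinB; have := umono _ _ (leqnSn k).
  by case: ltgtP => // ->; rewrite subrr.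
pose A : set (measurableTypeR R) := [set` `[0%R, +oo[].
have mA : measurable A by exact: measurable_itv.
pose h k (s : measurableTypeR R) : \bar R := level E f (u k) * (\1_(I k) s)%:E.
have h0 k s : 0 <= h k s by rewrite mule_ge0 ?level_ge0 ?lee_fin.
have m1 k : measurable_fun A (EFin \o \1_(I k)).
  by apply/measurable_EFinP; exact: measurable_indic.
have mh k : measurable_fun A (h k).
  by apply: emeasurable_funM; [exact: measurable_cst|exact: m1].
apply: (@le_trans _ _ (\int[lebesgue_measure]_(s in A) \sum_(k <oo) h k s)).
  apply: ge0_le_integral => //.
  - by move=> s _; exact: level_ge0.
  - exact: (mlevel _ E f).
  - exact: ge0_emeasurable_sum.
  move=> s; rewrite /A /= in_itv/= andbT => s0.
  (* [k] is the predecessor of the least index with [s < u k]; that index is not 0 because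
     [u 0 = 0 <= s]. *)
  have [k [uk uSk]] : exists k, (u k <= s)%R /\ (s < u k.+1)%R.
    case: (ex_minnP (uoo s)) => [[|k]]; first by rewrite u0 ltNge s0.
    move=> suk kmin; exists k; split => //; rewrite leNgt; apply/negP => /kmin.
    by rewrite ltnn.
  rewrite nneseries_esumT//; apply: le_trans (esum_ge1 _ _ k _ _) => //.
  rewrite /h indicE mem_set ?mule1; first exact: level_mono.
  by rewrite /I/= in_itv/= uk.
rewrite integral_nneseries//; apply: lee_nneseries.
  by move=> *; apply: integral_ge0 => s _; exact: h0.
move=> k _; rewrite ge0_integralZl//=; last exact: m1.
rewrite integral_indic// muleC lee_wpmul2r// -muI.
by apply: le_measure; rewrite ?inE//; exact: measurableI.
Qed.

(** The form in which tails are integrated: with [u k = k] for oscillations, and with doubling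
    levels for exponentials. *)
Lemma choquet_le_geometric E f (u : nat -> R) (c z : R) :
  u 0%N = 0%R -> {homo u : j k / (j <= k)%N >-> (j <= k)%R} ->
  (forall t, exists k, (t < u k)%R) -> (0 <= c)%R -> (0 < z < 1)%R ->
  (forall k, (u k.+1 - u k)%:E * hcontent delta [set x | E x /\ (u k)%:E < f x]
     <= (c * z ^+ k)%:E) ->
  choquet delta E f <= (c / (1 - z))%:E.
Proof.
move=> u0 umono uoo c0 /andP[z0 z1] uH.
apply: (le_trans (choquet_le_series E f u u0 umono uoo)).
apply: (@le_trans _ _ (\sum_(k <oo) (c * z ^+ k)%:E)).
  apply: lee_nneseries => k _ // _.
  by rewrite mule_ge0 ?hcontent_ge0// lee_fin subr_ge0 umono.
apply: lime_le.
  by apply: is_cvg_nneseries => k _ _; rewrite lee_fin mulr_ge0 ?exprn_ge0// ltW.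
apply: nearW => k; rewrite sumEFin lee_fin.
have := @geometric_le_lim R k c z c0 z0; rewrite ger0_norm ?(ltW z0)// => /(_ z1).
by rewrite /series/= /geometric.
Qed.

End Choquet.

(** * Dyadic subcubes of a cube *)

Section Dyadic.
Context {R : realType} {n : nat}.
Implicit Types (C P Q : @cube R n) (s : {ffun 'I_n -> bool}).

Definition child Q s : cube :=
  Cube (\row_i (corner Q ord0 i + (if s i then (edge Q)%:num / 2 else 0)))%R
       (((edge Q)%:num / 2)%:pos)%R.

(** A word is the address of a dyadic subcube, read from the root. Prefixes are ancestors, so
    maximal cubes with a property have addresses minimal for the prefix order. *)
Definition descend Q (a : seq {ffun 'I_n -> bool}) : cube := foldl child Q a.

(** All vertices of the closed cube; as cubes are left-open, only the one with every [s i] true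
    belongs to [cube_set C]. *)
Definition vertex C s : 'rV[R]_n :=
  (\row_i (corner C ord0 i + (if s i then (edge C)%:num else 0)))%R.

Lemma sub_child Q s : cube_set (child Q s) `<=` cube_set Q.
Proof.
move=> x xQ i; have /andP[] := xQ i; rewrite /child/= mxE => l1 l2.
have l0 : (0 < (edge Q)%:num)%R by [].
move: l0 l1 l2; move: ((edge Q)%:num)%R => e l0 l1 l2.
by apply/andP; split; move: l1 l2; case: (s i); lra.
Qed.

Lemma child_exists Q x : cube_set Q x -> exists s, cube_set (child Q s) x.
Proof.
(* The test is strict because the halves are right-closed: a midpoint belongs to the lower half. *)
move=> xQ; exists [ffun i => (corner Q ord0 i + (edge Q)%:num / 2 < x ord0 i)%R].
move=> i; have /andP[l1 l2] := xQ i; rewrite /child/= mxE ffunE.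
move: l1 l2; move: ((edge Q)%:num)%R => e l1 l2.
by case: (ltP (_ + e / 2)%R) => l3; apply/andP; split; lra.
Qed.

Lemma child_inj Q s t x :
  cube_set (child Q s) x -> cube_set (child Q t) x -> s = t.
Proof.
move=> xs xt; apply/ffunP => i; have /andP[] := xs i; have /andP[] := xt i.
rewrite /child/= !mxE; move: ((edge Q)%:num)%R => e.
by case: (s i); case: (t i) => //; lra.
Qed.

Lemma edge_descend Q a :
  (edge (descend Q a))%:num = ((edge Q)%:num / 2 ^+ size a)%R.
Proof.
elim: a Q => [|s a IH] Q /=; first by rewrite expr0 divr1.
by rewrite IH/= exprS invfM mulrA.
Qed.

Lemma sub_descend_cat Q a b : cube_set (descend Q (a ++ b)) `<=` cube_set (descend Q a).
Proof.
rewrite /descend foldl_cat -/(descend Q a); elim: b (descend Q a) => [|s b IH] P.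
  exact: subset_refl.
exact: subset_trans (IH _) (@sub_child P s).
Qed.

Lemma descend_exists Q x k : cube_set Q x ->
  exists2 a, size a = k & cube_set (descend Q a) x.
Proof.
elim: k Q => [|k IH] Q xQ; first by exists [::].
have [s xs] := child_exists Q x xQ; have [a ak xa] := IH _ xs.
by exists (s :: a) => //=; rewrite ak.
Qed.

(** Dyadic cubes with a common point are nested: siblings are disjoint, so the letters agree one
    after the other. *)
Lemma descend_prefix Q a b x : cube_set (descend Q a) x ->
  cube_set (descend Q b) x -> (size a <= size b)%N -> prefix a b.
Proof.
elim: a b Q => [|s a IH] b Q; first by rewrite prefix0s.
case: b => [//|t b] /= xa xb ab.
have st : s = t.
  apply: (child_inj Q s t x).
    exact: (sub_descend_cat _ [::] a).
  exact: (sub_descend_cat _ [::] b).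
by rewrite st eqxx/=; apply: (IH _ (child Q t)) => //; rewrite -st.
Qed.

(** Coordinatewise, when a side of [C] meets a side of [P] that is at least as long, the upper end
    of the first lies in the second if it starts no later, and its lower end does otherwise. *)
Lemma vertex_in_meet C P x : ((edge C)%:num <= (edge P)%:num)%R ->
  cube_set C x -> cube_set P x -> exists s, cube_set P (vertex C s).
Proof.
move=> CP xC xP; exists [ffun i => (corner C ord0 i <= corner P ord0 i)%R] => i.
have /andP[l1 l2] := xC i; have /andP[l3 l4] := xP i; rewrite /vertex mxE ffunE.
move: CP l1 l2 l3 l4; move: ((edge C)%:num)%R ((edge P)%:num)%R => c p CP l1 l2 l3 l4.
by case: (leP (corner C ord0 i) (corner P ord0 i)) => l5; apply/andP; split; lra.
Qed.

End Dyadic.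

(** * Stopping cubes for a set of small content *)

Lemma dyadic_scale {R : realType} (l L : R) : (0 < l <= L)%R ->
  exists k : nat, (l <= L / 2 ^+ k < 2 * l)%R.
Proof.
move=> /andP[l0 lL]; have L0 : (0 < L)%R by exact: lt_le_trans lL.
have ex : exists k : nat, (L / 2 ^+ k < 2 * l)%R.
  have [k] : exists k : nat, (L / (2 * l) < k.+1%:R)%R.
    by exists (Num.truncn (L / (2 * l))%R); exact: truncnS_gt.
  rewrite ltr_pdivrMr ?mulr_gt0// => Lk; exists k.
  rewrite ltr_pdivrMr ?exprn_gt0// (lt_le_trans Lk)// mulrC.
  rewrite ler_wpM2l ?mulr_ge0 ?(ltW l0)//.
  by rewrite -natrX ler_nat; exact: ltn_expl.
(* The least such [k] works: if [L / 2 ^+ k < l] with [k > 0], then [k - 1] would already satisfy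
   the bound. *)
case: (ex_minnP ex) => -[|k] kP kmin.
  by exists 0%N; rewrite kP expr0 divr1 lL.
exists k.+1; rewrite kP andbT leNgt; apply/negP => kl.
have : (L / 2 ^+ k < 2 * l)%R.
  move: kl; rewrite exprS invfM mulrCA mulrC ltr_pdivrMr//.
  by rewrite (mulrC l).
by move=> /kmin; rewrite ltnn.
Qed.

Lemma powR_double_le {R : realType} (n : nat) (delta l : R) :
  (delta <= n%:R)%R -> (0 <= l)%R -> ((2 * l) `^ delta <= 2 ^+ n * l `^ delta)%R.
Proof.
move=> dn l0; rewrite powRM// ler_wpM2r ?powR_ge0// -powR_mulrn//.
by rewrite ler_powR// ler1n.
Qed.

Lemma esum_finT_cst {R : realType} {T : finType} (c : R) : (0 <= c)%R ->
  \esum_(s in [set: T]) c%:E = (#|T|%:R * c)%:E.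
Proof.
move=> c0; transitivity
    (\esum_(s in [set: T]) \sum_(t <- enum T) (if t == s then c%:E else 0)).
  by apply: eq_esum => s _; rewrite big_enum/= -big_mkcond/= big_pred1_eq.
rewrite esum_sum; last by move=> s t _ _; case: ifP; rewrite ?lee_fin.
rewrite big_enum/= mulr_natl -sumr_const -sumEFin; apply: eq_bigr => t _.
rewrite -[RHS](@esum_set1 _ _ t (fun=> c%:E))// [RHS]esum_mkcond; apply: eq_esum => s _.
by rewrite classical_sets.in_set1 eq_sym.
Qed.

(* Constants: a dyadic cube with l <= l(P) < 2 l meeting a covering cube of edge
   l contains one of its vertices, hence exceeds the density 2^-n.+1, because
   2^-n.+1 < 2^-delta.  The final factor 1/2 pays for 2^n vertices per covering
   cube, for the density 2^-n.+1 and for 2^n when passing to the parents. *)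
Lemma stopping_cover {R : realType} {n : nat} (delta : R)
    (hdelta : (0 < delta <= n%:R)%R) (Q : @cube R n) (E : set 'rV[R]_n) :
  E `<=` cube_set Q ->
  hcontent delta E < ((2 ^- (3 * n).+2)%R * (edge Q)%:num `^ delta)%:E ->
  exists (B : set (seq {ffun 'I_n -> bool})) (P : seq {ffun 'I_n -> bool} -> @cube R n),
  [/\ E `<=` \bigcup_(b in B) cube_set (P b),
      forall b, B b -> cube_set (P b) `<=` cube_set Q,
      \esum_(b in B) ((edge (P b))%:num `^ delta)%:E <=
        (2^-1 * (edge Q)%:num `^ delta)%:E &
      forall b, B b -> hcontent delta (E `&` cube_set (P b)) <=
        (2 ^- n.+1 * (edge (P b))%:num `^ delta)%:E].
Proof.
move=> EQ /hcontent_lt_cover [D [C [EC sumC]]].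
have /andP[d0 dn] := hdelta.
set L := (edge Q)%:num in sumC *.
have L0 : (0 < L)%R by rewrite /L.
have Ld0 : (0 < L `^ delta)%R by rewrite powR_gt0.
pose w j := ((edge (C j))%:num `^ delta)%R.
have w0 j : (0 <= w j)%R by exact: powR_ge0.
(* Indexing by pairs of a cube and a vertex keeps the masses of coinciding vertices separate. *)
pose A (P : @cube R n) : set (nat * {ffun 'I_n -> bool}) :=
  [set k | D k.1 /\ cube_set P (vertex (C k.1) k.2)].
pose nu P := \esum_(k in A P) (w k.1)%:E.
pose bad a := ((2 ^- n.+1)%R * (edge (descend Q a))%:num `^ delta)%:E < nu (descend Q a).
have edgeP a : (0 < (edge (descend Q a))%:num)%R by [].
have nu_total : \esum_(k in D `*` [set: {ffun 'I_n -> bool}]) (w k.1)%:E <=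
    ((2 ^+ n)%R * (2 ^- (3 * n).+2 * L `^ delta))%:E.
  rewrite -(@esum_esum _ _ _ D (fun=> [set: {ffun 'I_n -> bool}])
    (fun j _ => (w j)%:E)); last first.
    by move=> *; rewrite lee_fin.
  under eq_esum => j _ do rewrite esum_finT_cst// EFinM.
  rewrite esumZl; last 2 first.
  - by rewrite ltr0n card_ffun card_bool card_ord expn_gt0.
  - by move=> j; rewrite lee_fin.
  rewrite card_ffun card_bool card_ord natrX EFinM lee_wpmul2l//; first exact: ltW.
(* An edge longer than [L] would by itself exceed the whole sum; this allows [dyadic_scale] to be
   applied to every covering cube. *)
have edgeC j : D j -> ((edge (C j))%:num <= L)%R.
  move=> Dj; rewrite leNgt; apply/negP => Lj.
  have wj : (w j)%:E < ((2 ^- (3 * n).+2)%R * L `^ delta)%:E.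
    apply: le_lt_trans sumC.
    by apply: (@esum_ge1 _ _ _ (fun j => (w j)%:E)) => //=; rewrite lee_fin.
  have : (L `^ delta <= w j)%R by rewrite /w ge0_ler_powR ?nnegrE// ltW.
  move: wj; rewrite lte_fin => wj; apply/negP; rewrite -ltNge (lt_le_trans wj)//.
  by rewrite ler_piMl ?powR_ge0// invf_le1 ?exprn_gt0// exprn_ege1// ler1n.
have comparable_bad j a x : D j -> cube_set (C j) x -> cube_set (descend Q a) x ->
    ((edge (C j))%:num <= (edge (descend Q a))%:num < 2 * (edge (C j))%:num)%R -> bad a.
  move=> Dj xC xa /andP[le1 lt2].
  have [s vs] := vertex_in_meet _ _ _ le1 xC xa.
  apply: (@lt_le_trans _ _ (w j)%:E); last first.
    by apply: (@esum_ge1 _ _ _ (fun k => (w k.1)%:E) (j, s)) => //=; rewrite lee_fin.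
  rewrite lte_fin.
  have : ((edge (descend Q a))%:num `^ delta <= 2 ^+ n * w j)%R.
    apply: le_trans (powR_double_le _ _ _ dn _) => //.
    by rewrite ge0_ler_powR ?nnegrE// ltW.
  rewrite [X in _ -> is_true (X < _)%R]mulrC ltr_pdivrMr ?exprn_gt0// => /le_lt_trans; apply.
  rewrite mulrC ltr_pM2l; first by rewrite exprS ltr_pMl ?exprn_gt0// ltr1n.
  by rewrite powR_gt0.
(* Addresses of the maximal bad cubes. *)
pose B : set (seq {ffun 'I_n -> bool}) :=
  [set b | bad b /\ forall a, prefix a b -> bad a -> a = b].
have Binj a b x : B a -> B b -> cube_set (descend Q a) x ->
    cube_set (descend Q b) x -> a = b.
  move=> [ba mina] [bb minb] xa xb; have [ab|/ltnW ba'] := leqP (size a) (size b).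
    by apply: minb => //; exact: descend_prefix xa xb ab.
  by apply/esym; apply: mina => //; exact: descend_prefix xb xa ba'.
have sub_take k a : cube_set (descend Q a) `<=` cube_set (descend Q (take k a)).
  by rewrite -{1}(cat_take_drop k a); exact: sub_descend_cat.
(* The total mass is at most [2 ^+ n * 2 ^- (3 * n).+2] times [L ^ delta], below the density
   [2 ^- n.+1]. Hence addresses in [B] are nonempty and have a genuine parent. *)
have root_good : ~ bad [::].
  rewrite /bad/= -/L => lt_nu.
  have := le_trans (esum_subset (A Q) (D `*` [set: _]) (fun k => (w k.1)%:E) _) nu_total.
  have AT : A Q `<=` D `*` [set: {ffun 'I_n -> bool}] by move=> k [].
  move=> /(_ AT) /(lt_le_trans lt_nu); rewrite lte_fin mulrA.
  rewrite ltr_pM2r// ltNge => /negP; apply.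
  rewrite ler_pdivrMr ?exprn_gt0// mulrC ler_pdivlMr ?exprn_gt0// -exprD.
  by rewrite ler_weXn2l ?ler1n//; lia.
have parent_good b a : B b -> prefix a (take (size b).-1 b) -> ~ bad a.
  move=> [bb minb] apb ba.
  have := minb a (prefix_trans apb (prefix_take _ _)) ba.
  case: b bb apb {minb} => [/root_good//|s b] _ /size_prefix/= /[swap] ->/=.
  by rewrite size_take/= leqnn ltnn.
pose P b := descend Q (take (size b).-1 b).
exists B, P; split.
- move=> x Ex; have [j Dj Cx] := EC x Ex; have Qx := EQ x Ex.
  have [k kP] : exists k : nat,
      ((edge (C j))%:num <= L / 2 ^+ k < 2 * (edge (C j))%:num)%R.
    by apply: dyadic_scale; rewrite edgeC// andbT.
  have [a ak ax] := descend_exists Q x k Qx.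
  have bada : bad a by apply: (comparable_bad j a x) => //; rewrite edge_descend ak.
  have ex : exists m, `[< bad (take m a) >].
    by exists (size a); rewrite take_size; apply/asboolP.
  (* The shortest bad prefix of the address of a bad cube around [x] lies in [B]. *)
  have [m /asboolP badm minm] := ex_minnP ex.
  exists (take m a); last by apply/(sub_take)/(sub_take).
  split => // c cm badc.
  have /eqP ca : take (size c) a == c.
    by rewrite -prefixE; apply: prefix_trans cm (prefix_take _ _).
  have mc : (m <= size c)%N by apply: minm; apply/asboolP; rewrite ca.
  move: cm; rewrite prefixE => /eqP <-; rewrite take_oversize//.
  by rewrite (leq_trans _ mc)// size_take_min geq_minl.
- by move=> b Bb; exact: (sub_descend_cat Q [::]).
- have edgePb b : B b -> ((edge (P b))%:num `^ delta)%:E <=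
      (2 ^+ n * 2 ^+ n.+1)%:E * nu (descend Q b).
    move=> [bb _]; have -> : ((edge (P b))%:num = 2 * (edge (descend Q b))%:num)%R.
      case: b bb => [/root_good//|s b] _.
      rewrite /P !edge_descend size_take/= leqnn.
      by rewrite exprS invfM mulrCA mulVKf.
    apply: (@le_trans _ _ (2 ^+ n * (edge (descend Q b))%:num `^ delta)%:E).
      by rewrite lee_fin powR_double_le.
    rewrite EFinM EFinM -muleA lee_wpmul2l//.
    move: bb; rewrite /bad EFinM => /ltW.
    by rewrite lee_pdivrMl ?exprn_gt0.
  apply: (@le_trans _ _ (\esum_(b in B) ((2 ^+ n * 2 ^+ n.+1)%:E * nu (descend Q b)))).
    exact: le_esum.
  have nu0 P' : 0 <= nu P' by apply: esum_ge0 => k _; rewrite lee_fin.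
  rewrite esumZl//.
  (* Disjointness of the stopping cubes: a vertex lies in at most one of them, so no mass is counted
     twice. *)
  have nuB : \esum_(b in B) nu (descend Q b) <=
      \esum_(k in D `*` [set: {ffun 'I_n -> bool}]) (w k.1)%:E.
    rewrite /nu (@esum_esum _ _ _ B (fun b => A (descend Q b))
      (fun _ k => (w k.1)%:E)); last first.
      by move=> *; rewrite lee_fin.
    rewrite -(@esum_image _ _ _ _ snd (fun k => (w k.1)%:E)); last first.
      move=> [b k] [b' k']; rewrite !inE/= => -[Bb [_ vb]] [Bb' [_ vb']] kk.
      by rewrite kk in vb *; rewrite (Binj b b' _ Bb Bb' vb vb').
    by apply: esum_subset => _ [[b k] [/= _ [Dk _]] <-].
  apply: (le_trans (lee_wpmul2l _ (le_trans nuB nu_total))).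
    by rewrite lee_fin mulr_ge0 ?exprn_ge0.
  rewrite -EFinM lee_fin !mulrA ler_pM2r//.
  (* Exponents: [n + n.+1 + n] is one less than [(3 * n).+2], which leaves the factor 1/2. *)
  rewrite ler_pdivrMr ?exprn_gt0// [in leRHS]exprS mulKf// -!exprD.
  by rewrite ler_weXn2l ?ler1n//; lia.
- move=> b Bb.
  have good : ~ bad (take (size b).-1 b) by apply: parent_good Bb (prefix_refl _).
  move/negP : good; rewrite -leNgt; apply: le_trans.
  apply: (@hcontent_cover _ _ _ _ _ (fun k => C k.1)) => x [Ex Px].
  have [j Dj Cx] := EC x Ex.
  (* A covering cube that meets the parent cannot be larger than it: the ancestor of comparable
     scale would be bad. So it has a vertex in the parent, and its term is counted by [nu (P b)]. *)
  have [s vs] : exists s, cube_set (P b) (vertex (C j) s).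
    apply: (vertex_in_meet (C j) (P b) x _ Cx Px); rewrite leNgt; apply/negP => edgePC.
    have [k kP] : exists k : nat,
      ((edge (C j))%:num <= L / 2 ^+ k < 2 * (edge (C j))%:num)%R.
      by apply: dyadic_scale; rewrite edgeC// andbT.
    apply: (parent_good b (take k (take (size b).-1 b)) Bb (prefix_take _ _)).
    apply: (comparable_bad j _ x Dj Cx); first exact: (sub_take _ _ _ Px).
    rewrite edge_descend size_take_min.
    suff /minn_idPl -> : (k <= size (take (size b).-1 b))%N by [].
    rewrite leqNgt; apply/negP => ltk; move: edgePC; apply/negP; rewrite -leNgt.
    have /andP[le1 _] := kP; apply: (le_trans le1).
    rewrite /P edge_descend ler_wpM2l ?(ltW L0)// lef_pV2 ?posrE ?exprn_gt0//.
    by rewrite ler_weXn2l ?ler1n// ltnW.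
  by exists (j, s).
Qed.

(** * The John-Nirenberg inequality *)

Definition osc_level {R : realType} {n : nat} (Q : @cube R n) (f : 'rV[R]_n -> R)
    (c t : R) : set 'rV[R]_n :=
  [set x | cube_set Q x /\ (t < `|f x - c|)%R].

(* Every oscillation estimate goes through this tail bound: unlike the Choquet
   integral, it needs neither measurability nor sublinearity. *)
Definition exp_tail {R : realType} {n : nat} (delta : R) (f : 'rV[R]_n -> R) (M b : R) :=
  forall Q : cube, exists c : R, forall t : R, (0 <= t)%R ->
    hcontent delta (osc_level Q f c t) <=
      (M * expR (- (b * t)) * (edge Q)%:num `^ delta)%:E.

(* t0 = 2^(3n+4) K brings Chebyshev's bound below the threshold of
   stopping_cover; t1 = 8 K makes the tail on a parent at most 1/4 of its
   content. *)
Definition jn_scale {R : realType} (n : nat) : R := (2 ^+ (3 * n).+2 * 4 + 8)%R.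

Lemma jn_scale_gt0 {R : realType} (n : nat) : (0 < jn_scale n :> R)%R.
Proof. by rewrite /jn_scale addr_gt0// mulr_gt0// exprn_gt0. Qed.

Section JohnNirenberg.
Context {R : realType} {n : nat}.
Variables (delta : R).
Hypothesis hdelta : (0 < delta <= n%:R)%R.
Implicit Types (f : 'rV[R]_n -> R) (Q : @cube R n) (g : 'rV[R]_n -> \bar R).

Lemma choquet_meanE Q g : choquet_mean delta Q g =
  ((edge Q)%:num `^ delta)^-1%:E * choquet delta (cube_set Q) g.
Proof. by rewrite /choquet_mean hcontent_cubeE// inver gt_eqF ?powR_gt0. Qed.

Lemma choquet_mean_le Q g (m : R) : choquet_mean delta Q g <= m%:E <->
  choquet delta (cube_set Q) g <= (m * (edge Q)%:num `^ delta)%:E.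
Proof. by rewrite choquet_meanE lee_pdivrMl ?powR_gt0// muleC -EFinM mulrC. Qed.

(** The factor 2 leaves room for a near-minimizer, since the infimum over [c] is not assumed to be
    attained. *)
Lemma bmo_center f (K : R) : (0 < K)%R -> bmo_norm delta f <= K%:E ->
  exists c : @cube R n -> R, forall Q,
    choquet delta (cube_set Q) (fun x => `|f x - c Q|%:E) <=
      (2 * K * (edge Q)%:num `^ delta)%:E.
Proof.
move=> K0 fK.
suff /choice[c fc] : forall Q, exists c, choquet delta (cube_set Q)
    (fun x => `|f x - c|%:E) <= (2 * K * (edge Q)%:num `^ delta)%:E by exists c.
move=> Q.
have : ereal_inf (range (fun c : R =>
    choquet_mean delta Q (fun x => `|f x - c|%:E))) < (2 * K)%:E.
  apply: le_lt_trans (_ : K%:E < _); last by rewrite lte_fin; lra.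
  by apply: le_trans fK; apply: ereal_sup_ubound; exists Q.
move=> /ereal_inf_lt[_ [c _ <-]] /ltW le_c.
by exists c; apply/choquet_mean_le.
Qed.

Lemma osc_level_chebyshev f Q (c m t : R) : (0 < t)%R ->
  choquet delta (cube_set Q) (fun x => `|f x - c|%:E) <= m%:E ->
  hcontent delta (osc_level Q f c t) <= (m / t)%:E.
Proof.
exact: choquet_level_le.
Qed.

(** Induction on [k]. The stopping parents cover the set where [f] is more than [t0] away from
    [c Q], and their centers are within [t0 + t1] of [c Q]; so a deviation above level [k + 1] on
    [Q] is one above level [k] on some parent, while the sum of the contents of the parents is at
    most half that of [Q]. *)
Lemma osc_level_halving f (K : R) (c : @cube R n -> R) : (0 < K)%R ->
  (forall Q, choquet delta (cube_set Q) (fun x => `|f x - c Q|%:E) <=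
      (2 * K * (edge Q)%:num `^ delta)%:E) ->
  forall k Q, hcontent delta (osc_level Q f (c Q) (k%:R * (jn_scale n * K))) <=
    (2 ^- k * (edge Q)%:num `^ delta)%:E.
Proof.
move=> K0 fc.
set t0 := (2 ^+ (3 * n).+2 * 4 * K)%R; set t1 := (8 * K)%R.
have -> : (jn_scale n * K)%R = (t0 + t1)%R by rewrite /jn_scale mulrDl.
have t0_gt0 : (0 < t0)%R by rewrite /t0 mulr_gt0// mulr_gt0// exprn_gt0.
have t1_gt0 : (0 < t1)%R by rewrite mulr_gt0.
elim=> [|k IH] Q.
  rewrite expr0 invr1 mul1r -(hcontent_cubeE _ hdelta).
  by apply: hcontent_mono => x [].
set E0 := osc_level Q f (c Q) t0.
have hQ : (0 < (edge Q)%:num `^ delta)%R by rewrite powR_gt0.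
have [||B [P [E0P PQ sumP E0thin]]] := stopping_cover delta hdelta Q E0.
- by move=> x [].
(* [2 * K / t0] is half the threshold [2 ^- (3 * n).+2], hence strictly below it. *)
- apply: le_lt_trans (osc_level_chebyshev f Q _ _ _ t0_gt0 (fc Q)) _.
  rewrite lte_fin mulrAC ltr_pM2r// /t0 ltr_pdivrMr//.
  by rewrite -mulrA mulKf ?expf_neq0// ltr_pM2r// ltr_nat.
have close b : B b -> (`|c (P b) - c Q| <= t0 + t1)%R.
  (* Otherwise the parent is the union of two sets of relative content at most [2 ^- n.+1 <= 1/2]
     and [1/4]. At such a [y] both centers are compared with [f y]. *)
  move=> Bb; have [y [Py yE yt1]] : exists y, [/\ cube_set (P b) y, ~ E0 y &
      (`|f y - c (P b)| <= t1)%R].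
    apply: contrapT => nex.
    have sub : cube_set (P b) `<=`
        (E0 `&` cube_set (P b)) `|` osc_level (P b) f (c (P b)) t1.
      move=> y Py; apply: contrapT => /not_orP[nE0 nosc]; apply: nex.
      exists y; split => //.
        by move=> Ey; apply: nE0.
      by rewrite leNgt; apply/negP => lt; apply: nosc.
    have := le_trans (hcontent_mono delta _ _ sub) (hcontentU _ _ _).
    rewrite hcontent_cubeE//; apply/negP; rewrite -ltNge.
    apply: le_lt_trans (leeD (E0thin b Bb)
      (osc_level_chebyshev f (P b) _ _ _ t1_gt0 (fc (P b)))) _.
    have hP : (0 < (edge (P b))%:num `^ delta)%R by rewrite powR_gt0.
    rewrite -EFinD lte_fin mulrAC -mulrDl gtr_pMl//.
    have -> : (2 * K / t1 = 4^-1)%R by rewrite /t1; field; rewrite gt_eqF.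
    have : (2 ^- n.+1 <= 2^-1 :> R)%R.
      by rewrite lef_pV2 ?posrE ?exprn_gt0// exprS ler_peMr// exprn_ege1// ler1n.
    by lra.
  have yt0 : (`|f y - c Q| <= t0)%R.
    rewrite leNgt; apply/negP => lt; apply: yE; split => //; exact: PQ Py.
  rewrite (_ : c (P b) - c Q = (f y - c Q) - (f y - c (P b)))%R; last by ring.
  by apply: le_trans (ler_normB _ _) (lerD yt0 yt1).
apply: (@le_trans _ _ (\esum_(b in B)
    hcontent delta (osc_level (P b) f (c (P b)) (k%:R * (t0 + t1))))).
  apply: le_trans (hcontent_bigcup _ _ _); apply: hcontent_mono => x [Qx lt_osc].
  have [b Bb Px] : (\bigcup_(b in B) cube_set (P b)) x.
    apply: E0P; split => //; apply: le_lt_trans lt_osc.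
    rewrite -natr1 mulrDl mul1r addrCA lerDl addr_ge0 ?mulr_ge0 ?addr_ge0// ltW//.
  exists b => //; split => //.
  have : (`|f x - c Q| <= `|f x - c (P b)| + `|c (P b) - c Q|)%R.
    by apply: le_trans (ler_normD _ _); rewrite addrA subrK.
  have := close b Bb; move: lt_osc; rewrite -natr1 mulrDl mul1r; lra.
apply: (@le_trans _ _ (\esum_(b in B) ((2 ^- k)%:E * ((edge (P b))%:num `^ delta)%:E))).
  by apply: le_esum => b _; rewrite -EFinM; exact: IH.
rewrite esumZl ?invr_gt0 ?exprn_gt0//.
apply: le_trans (lee_wpmul2l _ sumP) _; first by rewrite lee_fin invr_ge0 exprn_ge0.
by rewrite -EFinM mulrA -invfM -exprSr.
Qed.

(** The factor 2 pays for replacing [t / T] by its integer part. *)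
Lemma bmo_exp_tail f (K : R) : (0 < K)%R -> bmo_norm delta f <= K%:E ->
  exp_tail delta f 2 (ln 2 / (jn_scale n * K)).
Proof.
move=> K0 fK; have [c fc] := bmo_center f K K0 fK; move=> Q; exists (c Q) => t t_ge0.
set T := (jn_scale n * K)%R; have T0 : (0 < T)%R by rewrite mulr_gt0// jn_scale_gt0.
have /andP[ler_k lt_k] := truncn_itv (divr_ge0 t_ge0 (ltW T0)).
set k := Num.truncn (t / T) in ler_k lt_k.
apply: (@le_trans _ _ (hcontent delta (osc_level Q f (c Q) (k%:R * T)))).
  apply: hcontent_mono => x [Qx lt_t]; split => //; apply: le_lt_trans lt_t.
  by rewrite -ler_pdivlMr.
apply: le_trans (osc_level_halving f K c K0 fc k Q) _.
rewrite lee_fin ler_wpM2r ?powR_ge0// -[X in (X ^- k)%R](@lnK R) ?posrE//.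
rewrite -[X in (X * _)%R](@lnK R) ?posrE// -expRM_natr -expRN -expRD ler_expR.
have ln2 : (0 < ln 2 :> R)%R by rewrite ln_gt0// ltr1n.
rewrite mulrAC -mulrA -[X in (X - _)%R]mulr1 -mulrBr -mulrN ler_pM2l//.
by move: lt_k; rewrite -natr1; lra.
Qed.

End JohnNirenberg.

(** * From exponential tails to BMO and A_p *)

Lemma compact_sub_cube {R : realType} {n : nat} (K : set 'rV[R]_n) :
  compact K -> exists Q : @cube R n, K `<=` cube_set Q.
Proof.
move=> /compact_bounded[N [_ KN]]; pose m := (`|N| + 1)%R.
have Nm : (N < m)%R by rewrite /m ltr_pwDr// ler_norm.
have m0 : (0 < m)%R by rewrite /m ltr_wpDl.
(* The corner lies strictly below [- m] because cubes are left-open; the upper end is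
   [2 * m - 1 >= m] since [m >= 1]. *)
exists (Cube (\row_i (- m - 1))%R (PosNum (mulr_gt0 (ltr0n R 3) m0))) => x Kx i /=.
have := KN m Nm x Kx; rewrite [X in (X <= _)%R -> _]mx_normrE => xm.
have : (`|x ord0 i| <= m)%R.
  apply: le_trans xm.
  exact: (le_bigmax _ (fun ij : 'I_1 * 'I_n => `|x ij.1 ij.2|%R) (ord0, i)).
have m1 : (1 <= m)%R by rewrite /m lerDr.
rewrite ler_norml mxE => /andP[l1 l2].
by apply/andP; split; lra.
Qed.

Section ExpTail.
Context {R : realType} {n : nat}.
Variables (delta : R).
Hypothesis hdelta : (0 < delta <= n%:R)%R.
Implicit Types (f : 'rV[R]_n -> R) (Q : @cube R n) (g : 'rV[R]_n -> \bar R).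

Let expRNX (b : R) k : (expR (- b) ^+ k = expR (- (b * k%:R)))%R.
Proof. by rewrite -mulNr expRM_natr. Qed.

(* The next two facts are found by // in the applications of
   choquet_le_geometric. *)
Let nat_unbounded (t : R) : exists k, (t < k%:R)%R.
Proof. by exists (Num.truncn t).+1; exact: truncnS_gt. Qed.

Let nat_homo : {homo (fun k : nat => k%:R : R) : j k / (j <= k)%N >-> (j <= k)%R}.
Proof. by move=> j k; rewrite ler_nat. Qed.

Lemma exp_tail_bmo f (M b : R) : (0 <= M)%R -> (0 < b)%R ->
  exp_tail delta f M b -> bmo_norm delta f <= (M / (1 - expR (- b)))%:E.
Proof.
move=> M0 b0 fMb; apply: ge_ereal_sup => _ [Q _ <-].
have [c fc] := fMb Q.
apply: (@le_trans _ _ (choquet_mean delta Q (fun x => `|f x - c|%:E))).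
  by apply: ereal_inf_lbound; exists c.
apply/(choquet_mean_le _ hdelta); rewrite mulrAC.
apply: (choquet_le_geometric _ _ _ (fun k => k%:R)) => //.
- by rewrite mulr_ge0// powR_ge0.
- by rewrite expR_gt0 -expR0 ltr_expR oppr_lt0.
- move=> k; rewrite -natr1 addrAC subrr add0r mul1e expRNX mulrAC.
  exact: fc.
Qed.

Lemma exp_tail_L1loc f (M b : R) : (0 <= M)%R -> (0 < b)%R ->
  exp_tail delta f M b -> L1loc delta (EFin \o f).
Proof.
move=> M0 b0 fMb K /compact_sub_cube[Q KQ]; have [c fc] := fMb Q.
have z1 : (expR (- b) < 1)%R by rewrite -expR0 ltr_expR oppr_lt0.
set h := ((edge Q)%:num `^ delta)%R in fc; have h0 : (0 <= h)%R by exact: powR_ge0.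
(* The factor [expR (b * |c|)] pays for passing from [|f - c|] to [|f|]; the summand 1 covers the
   levels below [|c|], where only the content of [Q] is available. *)
pose A := ((1 + M) * expR (b * `|c|) * h)%R.
apply: (@le_lt_trans _ _ (A / (1 - expR (- b)))%:E); last exact: ltry.
apply: (choquet_le_geometric _ _ _ (fun k => k%:R)) => //.
- by rewrite /A mulr_ge0// mulr_ge0 ?expR_ge0// addr_ge0.
- by rewrite expR_gt0.
- move=> k; rewrite -natr1 addrAC subrr add0r mul1e expRNX.
  have -> : (A * expR (- (b * k%:R)) = (1 + M) * expR (- (b * (k%:R - `|c|))) * h)%R.
    by rewrite /A mulrBr opprB expRD; ring.
  have [ck|kc] := leP `|c|%R k%:R.
    apply: le_trans (_ : hcontent delta (osc_level Q f c (k%:R - `|c|)) <= _).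
      apply: hcontent_mono => x [Kx]; rewrite /= lte_fin => fx; split; first exact: KQ.
      have : (`|f x| <= `|f x - c| + `|c|)%R by rewrite -{1}(subrK c (f x)) ler_normD.
      by lra.
    apply: le_trans (fc _ _) _; first by rewrite subr_ge0.
    by rewrite lee_fin ler_wpM2r// ler_wpM2r ?expR_ge0// lerDr.
  apply: le_trans (_ : hcontent delta (cube_set Q) <= _).
    by apply: hcontent_mono => x [/KQ].
  rewrite hcontent_cubeE// -/h lee_fin ler_peMl//.
  rewrite -[leLHS]mul1r ler_pM// ?lerDl//.
  rewrite -[leLHS]expR0 ler_expR oppr_ge0; apply: mulr_ge0_le0; first exact: ltW.
  by rewrite subr_le0 ltW.
Qed.

(** At level [v * 2 ^+ j] the deviation [f - c] exceeds [j * ln 2 / a], and [2 * a <= b] bounds the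
    content by [M * 4^-1 ^+ j]; against increments [v * 2 ^+ j] this leaves a geometric series of
    ratio 1/2. The interval below [v] contributes the 1 in [1 + 2 * M]. *)
Lemma choquet_exp_le f Q (c M b a : R) : (0 <= M)%R -> (0 < a)%R -> (2 * a <= b)%R ->
  (forall t, (0 <= t)%R -> hcontent delta (osc_level Q f c t) <=
      (M * expR (- (b * t)) * (edge Q)%:num `^ delta)%:E) ->
  choquet delta (cube_set Q) (fun x => (expR (a * f x))%:E) <=
    (expR (a * c) * (2 * (1 + 2 * M)) * (edge Q)%:num `^ delta)%:E.
Proof.
move=> M0 a0 ab fc; set h := ((edge Q)%:num `^ delta)%R in fc *.
have h0 : (0 <= h)%R by exact: powR_ge0.
set v := expR (a * c); have v0 : (0 < v)%R by exact: expR_gt0.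
pose u (k : nat) : R := if k is j.+1 then (v * 2 ^+ j)%R else 0%R.
have -> : (v * (2 * (1 + 2 * M)) * h = (v * (1 + 2 * M) * h) / (1 - 2^-1))%R by field.
have uS k : (u k <= u k.+1)%R.
  case: k => [|k]; first by rewrite /u expr0 mulr1 ltW.
  by rewrite /u ler_pM2l// ler_weXn2l// ler1n.
apply: (choquet_le_geometric _ _ _ u) => //.
- by apply: homo_leq => //; exact: le_trans.
- move=> t; exists (Num.truncn (t / v)).+2.
  rewrite /u mulrC -ltr_pdivrMr//; apply: lt_trans (truncnS_gt _) _.
  by rewrite -natrX ltr_nat; exact: ltn_expl.
- by rewrite mulr_ge0// mulr_ge0 ?(ltW v0)// addr_ge0// mulr_ge0.
- by lra.
move=> [|k].
  rewrite /u expr0 mulr1 subr0 expr0 mulr1.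
  apply: (@le_trans _ _ (v%:E * h%:E)).
    rewrite lee_wpmul2l ?lee_fin ?(ltW v0)// /h -(hcontent_cubeE _ hdelta).
    by apply: hcontent_mono => x [].
  rewrite -EFinM lee_fin mulrAC ler_peMr ?mulr_ge0 ?(ltW v0)//.
  by rewrite lerDl mulr_ge0.
have -> : (u k.+2 - u k.+1 = v * 2 ^+ k)%R by rewrite /u exprS; ring.
have lev : hcontent delta [set x | cube_set Q x /\ (u k.+1)%:E < (expR (a * f x))%:E] <=
    (M * (4^-1) ^+ k * h)%:E.
  have ln2 : (0 < ln 2 :> R)%R by rewrite ln_gt0// ltr1n.
  have t0 : (0 <= k%:R * ln 2 / a)%R by rewrite divr_ge0 ?mulr_ge0 ?(ltW ln2) ?(ltW a0).
  apply: le_trans (_ : hcontent delta (osc_level Q f c (k%:R * ln 2 / a)) <= _).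
    apply: hcontent_mono => x [Qx]; rewrite lte_fin => ufx; split => //.
    apply: lt_le_trans (ler_norm _); rewrite ltr_pdivrMr// mulrBl.
    rewrite ltrBrDl -ltr_expR expRD.
    by rewrite expRM_natl lnK ?posrE// (mulrC c) (mulrC (f x)).
  apply: le_trans (fc _ t0) _; rewrite lee_fin ler_wpM2r// ler_wpM2l//.
  have -> : (4^-1 = expR (- (2 * ln 2)) :> R)%R.
    rewrite expRN (_ : 2 * ln 2 = ln 2 + ln 2)%R; last by ring.
    by rewrite expRD lnK ?posrE//; congr (_^-1)%R; ring.
  rewrite expRNX ler_expR lerN2 mulrA ler_pdivlMr//.
  rewrite (_ : 2 * ln 2 * k%:R * a = 2 * a * (k%:R * ln 2))%R; last by ring.
  by rewrite ler_wpM2r// mulr_ge0// ltW.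
apply: le_trans (lee_wpmul2l _ lev) _.
  by rewrite lee_fin mulr_ge0 ?exprn_ge0// ltW.
rewrite -EFinM lee_fin.
have -> : (v * 2 ^+ k * (M * 4^-1 ^+ k * h) = v * M * h * (2 * 4^-1) ^+ k)%R.
  by rewrite exprMn; ring.
have -> : (2 * 4^-1 = 2^-1 :> R)%R by field.
rewrite exprS mulrA ler_wpM2r ?exprn_ge0// ?invr_ge0//.
(* The levels are shifted by one, since [u 0 = 0]; the resulting extra factor 1/2 is the origin of
   the 2 in [2 * M]. *)
have -> : (v * M * h = v * (2 * M) * h * 2^-1)%R by field.
rewrite ler_wpM2r ?invr_ge0// ler_wpM2r// ler_wpM2l ?(ltW v0)//.
by rewrite lerDr.
Qed.

(** The exponential bound is applied to [f] with [a] and to [- f] with [a / (p - 1)], around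
    opposite centers. The factors [expR (a * c)] and [expR (- (a * c))] cancel, leaving
    [G * G ^ (p - 1)]. *)
Lemma exp_tail_Ap f (p M b a : R) : (1 < p)%R -> (0 <= M)%R -> (0 < a)%R ->
  (2 * a <= b)%R -> (2 * (a / (p - 1)) <= b)%R -> exp_tail delta f M b ->
  Ap p delta (fun x => (expR (a * f x))%:E) /\
  Ap_const p delta (fun x => (expR (a * f x))%:E) <= ((2 * (1 + 2 * M)) `^ p)%:E.
Proof.
move=> p1 M0 a0 ab apb fMb.
have q0 : (0 < p - 1)%R by rewrite subr_gt0.
set G := (2 * (1 + 2 * M))%R.
have G0 : (0 < G)%R by rewrite /G; lra.
suff le_const : Ap_const p delta (fun x => (expR (a * f x))%:E) <= (G `^ p)%:E.
  split=> //; split; last by apply: le_lt_trans le_const _; exact: ltry.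
  split; last first.
    exists set0; first exact: hcontent0.
    by move=> x _; rewrite lte_fin expR_gt0 ltry.
  move=> K /compact_sub_cube[Q KQ]; have [c fc] := fMb Q.
  apply: le_lt_trans (ltry _); apply: le_trans (choquet_exp_le f Q c M b a M0 a0 ab fc).
  apply: le_choquet => t t0; apply: hcontent_mono => x [Kx lt]; split; first exact: KQ.
  by move: lt; rewrite /= ger0_norm ?expR_ge0.
apply: ge_ereal_sup => _ [Q _ <-]; have [c fc] := fMb Q.
set a' := (a / (p - 1))%R.
have a'0 : (0 < a')%R by rewrite divr_gt0.
have fcN t : (0 <= t)%R -> hcontent delta (osc_level Q (fun x => - f x)%R (- c)%R t) <=
    (M * expR (- (b * t)) * (edge Q)%:num `^ delta)%:E.
  move=> t0; apply: le_trans (fc t t0); apply: hcontent_mono => x [Qx].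
  by rewrite opprK addrC distrC.
have mean1 : choquet_mean delta Q (fun x => (expR (a * f x))%:E) <= (expR (a * c) * G)%:E.
  by apply/(choquet_mean_le _ hdelta); exact: choquet_exp_le fc.
have mean2 : choquet_mean delta Q (fun x => (expR (a * f x))%:E `^ (- (1 / (p - 1)))) <=
    (expR (a' * - c) * G)%:E.
  apply/(choquet_mean_le _ hdelta).
  under eq_fun => x.
    rewrite poweR_EFin -expRM (_ : _ * _ = a' * - f x)%R; last by rewrite /a'; ring.
    over.
  exact: (choquet_exp_le (fun x => - f x)%R Q (- c)%R M b a').
have mean_ge0 g : 0 <= choquet_mean delta Q g.
  by rewrite choquet_meanE// mule_ge0 ?choquet_ge0// lee_fin invr_ge0 powR_ge0.
have mean2p : choquet_mean delta Q (fun x => (expR (a * f x))%:E `^ (- (1 / (p - 1))))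
     `^ (p - 1) <= (expR (- (a * c)) * G `^ (p - 1))%:E.
  apply: le_trans (gt0_ler_poweR (ltW q0) _ _ mean2) _.
  - by rewrite in_itv/= mean_ge0 leey.
  - by rewrite in_itv/= leey andbT lee_fin mulr_ge0 ?expR_ge0// ltW.
  rewrite poweR_EFin powRM ?expR_ge0 ?(ltW G0)// -expRM lee_fin.
  rewrite (_ : a' * - c * (p - 1) = - (a * c))%R//.
  by rewrite /a'; field; rewrite gt_eqF.
apply: le_trans (lee_pmul (mean_ge0 _) (poweR_ge0 _ _) mean1 mean2p) _.
rewrite -EFinM lee_fin mulrACA -expRD subrr expR0 mul1r.
rewrite -[X in (X * _)%R]powRr1 ?(ltW G0)// -powRD; last first.
  by rewrite (gt_eqF G0) implybT.
by rewrite addrC subrK.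
Qed.

End ExpTail.

(** * From A_p to exponential tails *)

Lemma cube_set_sub_compact {R : realType} {n : nat} (Q : @cube R n) :
  exists2 K : set 'rV[R]_n, compact K & cube_set Q `<=` K.
Proof.
pose A i : set R :=
  [set` `[(corner Q ord0 i), (corner Q ord0 i + (edge Q)%:num)%R]].
exists [set x : 'rV[R]_n | forall i, A i (x ord0 i)].
  by apply: (@rV_compact _ _ A) => i; exact: segment_compact.
by move=> x Qx i; rewrite /A/= in_itv/=; have /andP[/ltW -> ->] := Qx i.
Qed.

Section Muckenhoupt.
Context {R : realType} {n : nat}.
Variables (delta p : R).
Hypothesis hdelta : (0 < delta <= n%:R)%R.
Hypothesis hp : (1 < p)%R.
Implicit Types (w : 'rV[R]_n -> \bar R) (Q : @cube R n).

Let q := (1 / (p - 1))%R.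
Let v w := fun x : 'rV[R]_n => w x `^ (- q).

Let pm1_gt0 : (0 < p - 1)%R. Proof. by rewrite subr_gt0. Qed.
Let q0 : (0 < q)%R. Proof. by rewrite /q divr_gt0. Qed.
Let qpm1 : (q * (p - 1) = 1)%R. Proof. by rewrite /q mul1r mulVf// gt_eqF. Qed.

Let edge_powR_gt0 Q : (0 < (edge Q)%:num `^ delta)%R.
Proof. by rewrite powR_gt0. Qed.

Let mean_ge0 Q g : 0 <= choquet_mean delta Q g.
Proof.
by rewrite choquet_meanE// mule_ge0 ?choquet_ge0// lee_fin invr_ge0 powR_ge0.
Qed.

(** A zero mean would make the cube a union of two null sets, against its positive content. *)
Lemma choquet_mean_gt0 Q g : hc_ae delta (fun x => 0 < g x) -> 0 < choquet_mean delta Q g.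
Proof.
move=> [N N0 g0]; rewrite lt_neqAle mean_ge0 andbT eq_sym; apply/eqP => mean0.
have /choquet_eq0_level lev0 : choquet delta (cube_set Q) g = 0.
  have /(choquet_mean_le _ hdelta) : choquet_mean delta Q g <= 0%:E by rewrite mean0.
  by rewrite mul0r => le0; apply/eqP; rewrite eq_le le0 choquet_ge0.
have sub : cube_set Q `<=` [set x | cube_set Q x /\ 0 < g x] `|` N.
  move=> x Qx; have [Nx|Nx] := pselect (N x); first by right.
  by left; split => //; exact: g0.
have := le_trans (hcontent_mono delta _ _ sub) (hcontentU _ _ _).
rewrite lev0 N0 adde0.
by rewrite leNgt hcontent_cube_gt0.
Qed.

Lemma weight_mean_lty w Q : L1loc delta w -> choquet_mean delta Q w < +oo.
Proof.
move=> wL; have [K cK QK] := cube_set_sub_compact Q.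
rewrite choquet_meanE// lte_mul_pinfty ?lee_fin ?invr_ge0 ?powR_ge0//.
apply: le_lt_trans (wL K cK); apply: le_choquet => t _; apply: hcontent_mono.
move=> x [Qx tw]; split; first exact: QK.
by apply: lt_le_trans tw _; exact: lee_abs.
Qed.

(** Local integrability makes [W] finite; [V] is finite because [W > 0] and the product is bounded
    by a finite constant. *)
Lemma Ap_mean_bounds w Q : Ap p delta w ->
  exists W V : R, [/\ (0 < W)%R, (0 < V)%R, choquet_mean delta Q w = W%:E,
    choquet_mean delta Q (v w) = V%:E & (W * V `^ (p - 1))%:E <= Ap_const p delta w].
Proof.
move=> [[wL [N N0 Nw]] wA].
have W0 : 0 < choquet_mean delta Q w.
  by apply: choquet_mean_gt0; exists N => // x /Nw /andP[].
have V0 : 0 < choquet_mean delta Q (v w).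
  apply: choquet_mean_gt0; exists N => // x /Nw /andP[w0 _].
  exact: poweR_gt0.
have WV : choquet_mean delta Q w * choquet_mean delta Q (v w) `^ (p - 1) <=
    Ap_const p delta w by apply: ereal_sup_ubound; exists Q.
case: (choquet_mean delta Q w) W0 (weight_mean_lty w Q wL) WV => // W W0 _.
case: (choquet_mean delta Q (v w)) V0 => // [V V0 WV|_].
  by exists W, V; split.
rewrite poweRyr ?gt_eqF// gt0_muley// leye_eq => /eqP Ay.
by rewrite Ay in wA.
Qed.

(** Stands in for Hölder's inequality. By Chebyshev the sets where [w > 3 W] or [v > 3 V] fill at
    most two thirds of the content, so some point of [Q] satisfies both opposite bounds, and there
    the product of [w] and the power [p - 1] of [v w] is 1. *)
Lemma Ap_mean_lower w Q (W V : R) : weight delta w -> (0 < W)%R -> (0 < V)%R ->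
  choquet_mean delta Q w = W%:E -> choquet_mean delta Q (v w) = V%:E ->
  (1 <= 3 `^ p * (W * V `^ (p - 1)))%R.
Proof.
move=> [_ [N N0 Nw]] W0 V0 wW vV; set h := ((edge Q)%:num `^ delta)%R.
have h0 : (0 < h)%R by exact: edge_powR_gt0.
have [x [Qx Nx wx vx]] : exists x,
      [/\ cube_set Q x, ~ N x, w x <= (3 * W)%:E & v w x <= (3 * V)%:E].
  apply: contrapT => nex.
  have sub : cube_set Q `<=` N `|` ([set x | cube_set Q x /\ (3 * W)%:E < w x] `|`
      [set x | cube_set Q x /\ (3 * V)%:E < v w x]).
    move=> x Qx; apply: contrapT => /not_orP[Nx /not_orP[wx vx]]; apply: nex; exists x.
    by split => //; rewrite leNgt; apply/negP => lt; [apply: wx|apply: vx].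
  have := le_trans (hcontent_mono delta _ _ sub) (hcontentU _ _ _).
  rewrite N0 add0e => /le_trans /(_ (hcontentU _ _ _)); apply/negP; rewrite -ltNge.
  have lev (g : 'rV[R]_n -> \bar R) (m : R) : (0 < m)%R ->
      choquet_mean delta Q g = m%:E ->
      hcontent delta [set x | cube_set Q x /\ (3 * m)%:E < g x] <= (3^-1 * h)%:E.
    move=> m0 gm; rewrite (_ : 3^-1 * h = m * h / (3 * m))%R; last first.
      by field; rewrite gt_eqF.
    apply: choquet_level_le; first by rewrite mulr_gt0.
    by apply/(choquet_mean_le _ hdelta); rewrite gm.
  apply: le_lt_trans (leeD (lev _ _ W0 wW) (lev _ _ V0 vV)) _.
  rewrite hcontent_cubeE// -/h -EFinD lte_fin; lra.
move: (Nw x Nx) wx vx; rewrite /v; case: (w x) => // y /andP[].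
rewrite poweR_EFin lte_fin !lee_fin => y0 _ yW yV.
have yE : (y * (y `^ (- q)) `^ (p - 1) = 1)%R.
  by rewrite -powRrM mulNr qpm1 powRN powRr1 ?mulfV ?gt_eqF// ltW.
rewrite -[leLHS]yE (_ : 3 `^ p = 3 * 3 `^ (p - 1))%R; last first.
  by rewrite -[X in (X * _)%R]powRr1// -powRD ?subrKC// pnatr_eq0 implybT.
rewrite mulrACA -powRM ?(ltW V0)//.
apply: ler_pM => //; rewrite ?powR_ge0 ?(ltW y0)//.
by rewrite ge0_ler_powR ?nnegrE ?powR_ge0 ?(ltW pm1_gt0)// mulr_ge0// ltW.
Qed.

(** The upper tail of [ln w] is a level set of [w], the lower one a level set of [v w]; Chebyshev
    applies to each. *)
Lemma Ap_level_tail w Q (W V c t : R) : weight delta w ->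
  choquet_mean delta Q w = W%:E -> choquet_mean delta Q (v w) = V%:E ->
  hcontent delta (osc_level Q (fun x => ln (fine (w x))) c t) <=
    ((W * expR (- (c + t)) + V * expR (q * (c - t))) * (edge Q)%:num `^ delta)%:E.
Proof.
move=> [_ [N N0 Nw]] wW vV; set h := ((edge Q)%:num `^ delta)%R.
have lev (g : 'rV[R]_n -> \bar R) (m s : R) : choquet_mean delta Q g = m%:E ->
    hcontent delta [set x | cube_set Q x /\ (expR s)%:E < g x] <= (m * expR (- s) * h)%:E.
  move=> gm; rewrite mulrAC expRN; apply: choquet_level_le; first exact: expR_gt0.
  by apply/(choquet_mean_le _ hdelta); rewrite gm.
apply: (@le_trans _ _ (hcontent delta
  (N `|` ([set x | cube_set Q x /\ (expR (c + t))%:E < w x] `|`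
   [set x | cube_set Q x /\ (expR (- (q * (c - t))))%:E < v w x])))).
  apply: hcontent_mono => x [Qx osc]; have [Nx|Nx] := pselect (N x); [by left|right].
  move: (Nw x Nx) osc => + osc; rewrite /v /= => /andP[]; case: (w x) osc => // y osc.
  rewrite lte_fin => y0 _.
  rewrite !lte_fin /powR gt_eqF// !ltr_expR.
  move: osc; rewrite ltr_normr => /orP[lt|lt]; [left|right]; split => //.
    by rewrite -ltr_ln ?posrE ?expR_gt0// expRK; lra.
  by rewrite mulNr ltrN2 ltr_pM2l//; lra.
apply: le_trans (hcontentU _ _ _) _; rewrite N0 add0e.
apply: le_trans (hcontentU _ _ _) _.
rewrite mulrDl EFinD; apply: leeD; first exact: lev.
by have := lev _ _ (- (q * (c - t)))%R vV; rewrite opprK.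
Qed.

Lemma Ap_exp_tail w : Ap p delta w ->
  exists2 X : R, Ap_const p delta w = X%:E &
    exp_tail delta (fun x => ln (fine (w x)))
      ((1 + 3 `^ p) * X `^ (Num.min 1 q))%R (Num.min 1 q)%R.
Proof.
move=> wA; have wW : weight delta w by case: wA.
(* Any cube would do: it gives a real lower bound, so the supremum is not [-oo]. *)
pose Q0 : @cube R n := Cube 0%R (PosNum ltr01).
have [X XE] : exists X : R, Ap_const p delta w = X%:E.
  have [W [V [W0 V0 _ _ le]]] := Ap_mean_bounds w Q0 wA.
  by case: (Ap_const p delta w) le (wA.2) => // X _ _; exists X.
exists X => // Q; set m := Num.min 1%R q.
have [W [V [W0 V0 meanW meanV le]]] := Ap_mean_bounds w Q wA.
move: le; rewrite XE lee_fin => leX.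
have WV0 : (0 < W * V `^ (p - 1))%R by rewrite mulr_gt0 ?powR_gt0.
have X0 : (0 < X)%R by exact: lt_le_trans leX.
have low : (1 <= 3 `^ p * X)%R.
  apply: le_trans (Ap_mean_lower w Q W V wW W0 V0 meanW meanV) _.
  by rewrite ler_wpM2l// powR_ge0.
have m0 : (0 <= m)%R by rewrite /m le_min ler01 ltW.
have m1 : (m <= 1)%R by rewrite /m ge_min lexx.
have mq : (m <= q)%R by rewrite /m ge_min lexx orbT.
(* This absorbs the additive 1 in [1 + X ^ m] into a multiple of [X ^ m]. *)
have lowm : (1 <= 3 `^ p * X `^ m)%R.
  have pX : (1 <= (3 `^ p * X) `^ m)%R.
    rewrite [leLHS](_ : _ = 1 `^ m)%R; last by rewrite powR1.
    by rewrite ge0_ler_powR ?nnegrE// mulr_ge0 ?powR_ge0// ltW.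
  apply: le_trans pX _; rewrite powRM ?powR_ge0 ?(ltW X0)// ler_wpM2r ?powR_ge0//.
  rewrite -[leRHS]powRr1 ?powR_ge0// ler_powR//.
  by rewrite -[leLHS](@powRr0 R 3) ler_powR ?ler1n// (ltW (lt_trans ltr01 hp)).
suff [c cP] : exists c, (W * expR (- c) + V * expR (q * c) <= 1 + X `^ m)%R.
  exists c => t t0; apply: le_trans (Ap_level_tail w Q W V c t wW meanW meanV) _.
  rewrite lee_fin ler_wpM2r ?powR_ge0//.
  have e1 : (expR (- t) <= expR (- (m * t)))%R.
    by rewrite ler_expR lerN2 ler_piMl.
  have e2 : (expR (- (q * t)) <= expR (- (m * t)))%R.
    by rewrite ler_expR lerN2 ler_wpM2r.
  rewrite opprD expRD mulrBr expRD !mulrA.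
  apply: (@le_trans _ _ ((W * expR (- c) + V * expR (q * c)) * expR (- (m * t)))%R).
    rewrite mulrDl; apply: lerD; rewrite ler_wpM2l// mulr_ge0 ?expR_ge0// ltW//.
  rewrite ler_wpM2r ?expR_ge0//; apply: le_trans cP _.
  by rewrite mulrDl mul1r; lra.
(* The center normalizes one of the two summands to 1; the other becomes [(W * V ^ (p - 1)) ^ q] if
   [q <= 1], and [W * V ^ (p - 1)] otherwise. *)
have [q1|q1] := leP q 1%R.
  exists (ln W); rewrite expRN lnK ?posrE// mulfV ?gt_eqF// lerD2l.
  have -> : m = q by rewrite /m; apply/min_idPr.
  have <- : ((W * V `^ (p - 1)) `^ q = V * expR (q * ln W))%R.
    rewrite powRM ?powR_ge0 ?(ltW W0)// -powRrM (mulrC (p - 1)%R) qpm1 powRr1 ?(ltW V0)//.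
    by rewrite mulrC /powR gt_eqF.
  by rewrite ge0_ler_powR ?nnegrE ?(ltW q0) ?(ltW WV0) ?(ltW X0).
exists (- ((p - 1) * ln V))%R; rewrite opprK mulrN mulrA qpm1 mul1r expRN lnK ?posrE//.
rewrite mulfV ?gt_eqF// addrC lerD2l.
have -> : m = 1%R by rewrite /m; apply/min_idPl; exact: ltW.
rewrite powRr1 ?(ltW X0)//; apply: le_trans leX.
by rewrite /powR gt_eqF.
Qed.

End Muckenhoupt.

(** * Assembly of the equivalence and of the two quantitative bounds *)

Theorem theorem1p1 (R : realType) (n : nat) (delta p : R)
    (hdelta : (0 < delta <= n%:R)%R) (hp : (1 < p)%R) :
  (forall f : 'rV[R]_n -> R,
     BMO delta f <->
     exists2 alpha : R, (0 < alpha)%R &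
       Ap p delta (fun x => (expR (alpha * f x))%:E)) /\
  (exists2 C : R, (0 < C)%R &
     forall w : 'rV[R]_n -> \bar R, Ap p delta w ->
       BMO delta (fun x => ln (fine (w x))) /\
       bmo_norm delta (fun x => ln (fine (w x))) <=
         C%:E * Ap_const p delta w `^ (Num.min 1 (1 / (p - 1)))%R) /\
  (exists c1 c2 : R, [/\ (0 < c1)%R, (0 < c2)%R &
     forall f : 'rV[R]_n -> R, BMO delta f -> bmo_norm delta f != 0 ->
       Ap p delta (fun x => (expR (c1 * f x / fine (bmo_norm delta f)))%:E) /\
       Ap_const p delta
         (fun x => (expR (c1 * f x / fine (bmo_norm delta f)))%:E) <= c2%:E]).
Proof.
have q0 : (0 < 1 / (p - 1))%R by rewrite divr_gt0// subr_gt0.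
set q := (1 / (p - 1))%R in q0 *.
have m0 : (0 < Num.min 1 q)%R by rewrite lt_min ltr01.
have tail_const0 X : (0 <= (1 + 3 `^ p) * X `^ (Num.min 1 q) :> R)%R.
  by rewrite mulr_ge0 ?powR_ge0// addr_ge0 ?powR_ge0.
(* The factor [1 + q] makes [a] small enough for both [exp (a f)] and the dual exponential of rate
   [a * q]; dividing by [K] makes the remaining constant independent of [f]. *)
have exp_small f (K : R) : (0 < K)%R -> bmo_norm delta f <= K%:E ->
    exists2 a : R, a = (ln 2 / (2 * jn_scale n * (1 + q)) / K)%R &
    [/\ (0 < a)%R, Ap p delta (fun x : 'rV[R]_n => (expR (a * f x))%:E) &
    Ap_const p delta (fun x => (expR (a * f x))%:E) <= ((2 * (1 + 2 * 2)) `^ p)%:E].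
  move=> K0 /(bmo_exp_tail delta hdelta f K K0) ftail.
  have ln2 : (0 < ln 2 :> R)%R by rewrite ln_gt0// ltr1n.
  have J0 := @jn_scale_gt0 R n.
  set a := (ln 2 / (2 * jn_scale n * (1 + q)) / K)%R; exists a => //.
  have a0 : (0 < a)%R by rewrite !divr_gt0// !mulr_gt0// addr_gt0.
  have aE : (2 * a * (1 + q) = ln 2 / (jn_scale n * K))%R.
    by rewrite /a; field; rewrite !gt_eqF// addr_gt0.
  have a2 : (0 <= 2 * a)%R by rewrite mulr_ge0// (ltW a0).
  have ab : (2 * a <= ln 2 / (jn_scale n * K))%R.
    by rewrite -aE ler_peMr// lerDl (ltW q0).
  have aqb : (2 * (a / (p - 1)) <= ln 2 / (jn_scale n * K))%R.
    rewrite (_ : 2 * (a / (p - 1)) = 2 * a * q)%R; last by rewrite /q; ring.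
    by rewrite -aE ler_wpM2l// lerDr.
  have M0 : (0 <= 2 :> R)%R by [].
  by have [] := exp_tail_Ap delta hdelta f p 2 _ a hp M0 a0 ab aqb ftail.
split; [|split].
- move=> f; split=> [[fL fB]|[a a0 fA]].
    have [K K0 fK] : exists2 K : R, (0 < K)%R & bmo_norm delta f <= K%:E.
      case: (bmo_norm delta f) fB => [r _| |] //; last by exists 1%R; rewrite ?leNye.
      (* Adding 1 keeps [K] positive even when the norm vanishes. *)
      exists (`|r| + 1)%R; first by rewrite ltr_wpDl.
      by rewrite lee_fin (le_trans (ler_norm r))// lerDl.
    by have [a _ [a0 fA _]] := exp_small f K K0 fK; exists a.
  have [X _ ftail] := Ap_exp_tail delta p hdelta hp _ fA.
  (* Tails of [a * f] around [c] are tails of [f] around [c / a], with the rate multiplied by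
     [a]. *)
  have {}ftail : exp_tail delta f ((1 + 3 `^ p) * X `^ (Num.min 1 q))%R
      (Num.min 1 q * a)%R.
    move=> Q; have [c fc] := ftail Q; exists (c / a)%R => t t0.
    have /fc : (0 <= a * t)%R by rewrite mulr_ge0// ltW.
    rewrite mulrA; apply: le_trans; apply: hcontent_mono => x [Qx lt_osc]; split => //.
    rewrite /= expRK (_ : a * f x - c = a * (f x - c / a))%R; last first.
      by field; rewrite gt_eqF.
    by rewrite normrM gtr0_norm// ltr_pM2l.
  have b0 : (0 < Num.min 1 q * a)%R by rewrite mulr_gt0.
  split; first exact: exp_tail_L1loc ftail.
  by apply: le_lt_trans (exp_tail_bmo delta hdelta f _ _ _ b0 ftail) _; rewrite ?ltry.
- have z0 : (0 < 1 - expR (- Num.min 1 q) :> R)%R.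
    by rewrite subr_gt0 -[ltRHS]expR0 ltr_expR oppr_lt0.
  exists ((1 + 3 `^ p) / (1 - expR (- Num.min 1 q)))%R.
    by rewrite divr_gt0// ltr_pwDl// powR_ge0.
  move=> w wA; have [X XE wtail] := Ap_exp_tail delta p hdelta hp w wA.
  have := exp_tail_bmo delta hdelta _ _ _ (tail_const0 X) m0 wtail.
  move=> w_bmo; split; last first.
    by rewrite XE poweR_EFin -EFinM mulrAC.
  split; first exact: exp_tail_L1loc wtail.
  by apply: le_lt_trans w_bmo _; rewrite ltry.
- exists (ln 2 / (2 * jn_scale n * (1 + q)))%R, ((2 * (1 + 2 * 2)) `^ p)%R; split.
  + by rewrite divr_gt0 ?ln_gt0 ?ltr1n// !mulr_gt0// ?jn_scale_gt0// addr_gt0.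
  + by rewrite powR_gt0// mulr_gt0// addr_gt0.
  move=> f [_ fB] f0.
  (* Together with the nonvanishing and the finiteness of the norm, this makes it a positive real,
     which can serve as [K]. *)
  have norm_ge0 : 0 <= bmo_norm delta f.
    apply: (@le_trans _ _ (ereal_inf (range (fun c : R =>
      choquet_mean delta (Cube (0%R : 'rV[R]_n) (PosNum ltr01))
        (fun x => `|f x - c|%:E))))).
      apply: le_ereal_inf_tmp => _ [c _ <-].
      by rewrite choquet_meanE// mule_ge0 ?choquet_ge0// lee_fin invr_ge0 powR_ge0.
    by apply: ereal_sup_ubound; exists (Cube 0%R (PosNum ltr01)).
  case: (bmo_norm delta f) fB f0 norm_ge0 (exp_small f) => // K _ K_neq0 K_ge0 small.
  have K0 : (0 < K)%R by rewrite lt_neqAle eq_sym -!lee_fin K_ge0 andbT.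
  have [a aE [_ fA fc2]] := small K K0 (lexx _).
  have fE : (fun x => (expR (ln 2 / (2 * jn_scale n * (1 + q)) * f x / fine K%:E))%:E) =
      (fun x => (expR (a * f x))%:E).
    by apply/funext => x; rewrite aE /= mulrAC.
  by rewrite fE.
Qed.
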